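(* Let $K$ be a virtual knot, let $U(K)$ be its unknotting index, let $M$ be its virtual knot module, and let $e(M)$ be the minimal number of $\Lambda$-generators of $M$, where $\Lambda=\mathbb{Z}[t,t^{-1}]$. If $U(K)=(m,n)$, then $e(M)\leq m+n$.
   Context: Virtual knots. A virtual knot diagram is a generic immersion of an oriented circle into the plane whose finitely many transverse double points are each either a real crossing (equipped with over/under information) or a virtual crossing (marked by a small circle, with no over/under information). The word ''crossing'' without qualifier means real crossing. A virtual knot is an equivalence class of such diagrams under planar isotopy, the classical Reidemeister moves RI, RII, RIII (on real crossings), the virtual moves VRI, VRII, VRIII (the same moves with all crossings virtual), and the mixed move VRIV (an arc all of whose crossings in the move are virtual is moved across a real crossing). The trivial knot is the virtual knot presented by a diagram with no crossings. Unknotting index. For non-negative integers $m,n$, a diagram $D$ is $(m,n)$-unknottable if $D$ is changed into a diagram of the trivial knot by changing $m$ real crossings of $D$ into virtual crossings (''virtualizing'') and applying crossing changes (switching over and under) on $n$ real crossings of $D$. $U(D)$ is the minimum, with respect to the dictionary (lexicographic) order, of all pairs $(m,n)$ such that $D$ is $(m,n)$-unknottable; $U(K)$ is the minimum (in the dictionary order) of $U(D)$ over all diagrams $D$ presenting $K$. Virtual knot module. The group $G$ of $K$ is given by the Wirtinger presentation of any diagram $D$ of $K$: there is one generator for each arc of $D$ running from an under crossing to the next under crossing (virtual crossings being ignored; a single generator if there are no real crossings), and one relation for each real crossing, namely $z = y^{-1}xy$, where $y$ is the generator of the over arc and $x$, $z$ are the generators of the under arcs on its left and on its right, respectively (with respect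 to the orientation of the over arc; virtual crossings give no relation). Its isomorphism class depends only on $K$. Let $G'$ and $G''$ be the first and second commutator subgroups of $G$. Then $G/G'\cong\mathbb{Z}$, and $M=G'/G''$ is a finitely generated $\Lambda$-module, with $t$ acting by conjugation by a Wirtinger generator; $M$ is called the virtual knot module of $K$. (By convention $e(0)=0$.) *)

(* Defs.v *)
From HB Require Import structures.
From Stdlib Require Import Relation_Operators.
From mathcomp Require Import all_boot all_order all_algebra.
From mathcomp Require Import boolp.

Set Implicit Arguments.
Unset Strict Implicit.
Unset Printing Implicit Defensive.

Import Order.TTheory GRing.Theory.

Local Open Scope quotient_scope.

(** * Virtual knot diagrams

   A generic immersion of an oriented circle into the plane, with a base point
   which is not a double point, is described up to isotopy of the plane by:
   - the list of the visits to its double points, in the order in which they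
     are met from the base point;
   - at each visit, the side from which the other strand comes;
   - the unbounded region.
   The base point is always taken on the boundary of the unbounded region, so
   that this region is described by the side of the base point on which it
   lies.  Virtual crossings are part of the list. *)

Inductive strand_level := Over | Under | Virtual.

Definition level_code (a : strand_level) : option bool :=
  match a with Over => Some true | Under => Some false | Virtual => None end.
Definition level_decode (a : option bool) : strand_level :=
  match a with Some true => Over | Some false => Under | None => Virtual end.
Lemma level_codeK : cancel level_code level_decode. Proof. by case. Qed.
HB.instance Definition _ :=
  Countable.copy strand_level (can_type level_codeK).

Definition flip (a : strand_level) : strand_level :=
  match a with Over => Under | Under => Over | Virtual => Virtual end.

(* [leftward v] holds when the other strand of the crossing goes from the right
   to the left of the strand which is making the visit [v]. *)
Record visit := Visit
  { label : nat; leftward : bool; level : strand_level }.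

Definition visit_code (v : visit) := (label v, leftward v, level v).
Definition visit_decode (p : nat * bool * strand_level) : visit :=
  Visit p.1.1 p.1.2 p.2.
Lemma visit_codeK : cancel visit_code visit_decode. Proof. by case. Qed.
HB.instance Definition _ := Countable.copy visit (can_type visit_codeK).

(* the visit to the same crossing by its other strand *)
Definition mate (v : visit) : visit :=
  Visit (label v) (~~ leftward v) (flip (level v)).

Definition well_formed (w : seq visit) : bool :=
  all (fun v => (mate v \in w) && (count (fun v' => label v' == label v) w == 2))
      w.

(** ** Planarity

   Edge [i] is the edge of the curve which ends at visit [i]; it starts at visit
   [i - 1], cyclically.  A pair [(i, s)] stands for the left ([s = true]) or
   the right ([s = false]) side of edge [i].  The map [next_side] follows the
   boundary of a region, keeping it on the left: [(i, true)] is traversed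
   forward, [(i, false)] is traversed backward, and one turns left at each
   crossing.  The regions are the orbits, and by Euler's formula a (connected)
   curve with c double points lies in the plane when it has c + 2 regions. *)
Section Faces.
Variable w : seq visit.

Definition visit_at (i : 'I_(size w)) : visit := tnth (in_tuple w) i.

Definition other (i : 'I_(size w)) : 'I_(size w) :=
  odflt i [pick j | visit_at j == mate (visit_at i)].

Definition next_side (e : 'I_(size w) * bool) : 'I_(size w) * bool :=
  let: (i, s) := e in
  let j := if s then i else ord_pred i in
  if leftward (visit_at j) == s then (ordS (other j), true)
  else (other j, false).

Definition same_region : rel ('I_(size w) * bool) := fconnect next_side.

Definition planar : bool :=
  nilp w || (fcard next_side predT == (size w)./2 + 2).

End Faces.

(* In [(w, s)], [s] tells on which side of the base point (left if [s = true])
   the unbounded region lies.  The two codes [([::], s)] are the two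
   orientations of an embedded circle. *)
Definition plane_code := (seq visit * bool)%type.
Definition is_diagram (c : plane_code) : bool :=
  well_formed c.1 && planar c.1.

Record diagram := Diagram { code :> plane_code; _ : is_diagram code }.
HB.instance Definition _ := [isSub for code].
HB.instance Definition _ := [Countable of diagram by <:].

Definition visits (D : diagram) : seq visit := (code D).1.

(** ** Equivalence

   Each constructor describes a move which takes place away from the base
   point.  They are only used between diagrams, so that the labels of the
   created crossings are automatically new, and planarity makes the loop, the
   bigon or the triangle of the move an empty region. *)

(* The three levels are those of strand 1 at its crossing with strand 2, of
   strand 1 at its crossing with strand 3, and of strand 2 at its crossing with
   strand 3.  Either at least two crossings are virtual (VRIII and VRIV), or
   all are real and one strand lies over the two others, another one under
   the two others (RIII). *)
Definition triangle_levels (l12 l13 l23 : strand_level) : bool :=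
  let nvirtual := count_mem Virtual [:: l12; l13; l23] in
  (2 <= nvirtual) || (nvirtual == 0) && ((l12 == l23) ==> (l13 == l12)).

Definition ordered (f : bool) (u v : visit) : seq visit :=
  if f then [:: u; v] else [:: v; u].

Inductive move : plane_code -> plane_code -> Prop :=
(* the same diagram with other names for its crossings *)
| Relabel (r : nat -> nat) w s : injective r ->
    move (w, s)
      ([seq Visit (r (label v)) (leftward v) (level v) | v <- w], s)
(* the same diagram with another base point next to the unbounded region *)
| Rebase w s (i0 i : 'I_(size w)) s' : i0 = 0 :> nat ->
    same_region (i0, s) (i, s') ->
    move (w, s) (rot i w, s')
(* RI, and VRI when [level v = Virtual] *)
| Move1 w0 w1 v s :
    move (w0 ++ w1, s) (w0 ++ [:: v; mate v] ++ w1, s)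
(* RII, and VRII when [level u = Virtual]; the two strands have the same
   direction when [f = true] *)
| Move2 w0 w1 w2 u v f s :
    leftward u != leftward v -> level u = level v ->
    move (w0 ++ w1 ++ w2, s)
      (w0 ++ [:: u; v] ++ w1 ++ ordered f (mate u) (mate v) ++ w2, s)
(* RIII, VRIII and VRIV.  Strand 1 makes the visits x (crossing strand 2) and
   y (crossing strand 3), strand 2 makes mate x and z (crossing strand 3),
   strand 3 makes mate y and mate z; [f1], [f2] and [f3] give the order of the
   two visits of each strand.  The three edges bound a region when, for some
   choice of one side of each edge, at each corner the next edge lies on
   the chosen side; eliminating these sides leaves the two stated equations. *)
| Move3 w0 w1 w2 w3 x y z (f1 f2 f3 : bool) s :
    leftward x (+) leftward y = f2 (+) f3 ->
    leftward x (+) leftward z = f1 (+) f3 ->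
    triangle_levels (level x) (level y) (level z) ->
    move
      (w0 ++ ordered f1 x y ++ w1 ++ ordered f2 (mate x) z ++ w2
          ++ ordered f3 (mate y) (mate z) ++ w3, s)
      (w0 ++ ordered (~~ f1) x y ++ w1 ++ ordered (~~ f2) (mate x) z ++ w2
          ++ ordered (~~ f3) (mate y) (mate z) ++ w3, s).

Definition equivalent : diagram -> diagram -> Prop :=
  clos_refl_sym_trans diagram (fun D E => move (code D) (code E)).

Definition equivalentb : rel diagram := fun D E => `[< equivalent D E >].

Lemma equivalentb_refl : reflexive equivalentb.
Proof. by move=> D; apply/asboolP/rst_refl. Qed.
Lemma equivalentb_sym : symmetric equivalentb.
Proof. by move=> D E; apply/asboolP/asboolP; apply: rst_sym. Qed.
Lemma equivalentb_trans : transitive equivalentb.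
Proof. by move=> E D F /asboolP DE /asboolP EF; apply/asboolP; exact: rst_trans DE EF. Qed.
Canonical diagram_equiv :=
  EquivRel equivalentb equivalentb_refl equivalentb_sym equivalentb_trans.

Definition virtual_knot := {eq_quot diagram_equiv}.
HB.instance Definition _ := Choice.on virtual_knot.
HB.instance Definition _ := EqQuotient.on virtual_knot.

Definition presents (D : diagram) (K : virtual_knot) : Prop :=
  \pi_virtual_knot D = K.

(* "a diagram of the trivial knot" *)
Definition trivial_diagram (D : diagram) : Prop :=
  exists2 O : diagram, visits O = [::] & equivalent D O.

(** * Unknotting index *)

(* virtualize the crossings in [A], switch over and under at those in [B] *)
Definition alter (A B : seq nat) (v : visit) : visit :=
  Visit (label v) (leftward v)
    (if label v \in A then Virtual
     else if label v \in B then flip (level v) else level v).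

Definition real_crossings (D : diagram) : seq nat :=
  [seq label v | v <- visits D & level v == Under].

(* Changing levels does not affect the plane curve, hence yields a diagram. *)
Definition unknottable (D : diagram) (m n : nat) : Prop :=
  exists (A B : seq nat) (D' : diagram),
    [/\ uniq (A ++ B) /\ {subset A ++ B <= real_crossings D},
        size A = m, size B = n,
        code D' = (map (alter A B) (visits D), (code D).2)
      & trivial_diagram D'].

Definition is_lex_min (P : nat -> nat -> Prop) (m n : nat) : Prop :=
  P m n /\
  forall m' n', P m' n' -> (((m, n) : nat *l nat) <= (m', n'))%O.

(* [U(D) = (m, n)] *)
Definition diagram_unknotting_index (D : diagram) : nat -> nat -> Prop :=
  is_lex_min (unknottable D).

(* [U(K) = (m, n)] *)
Definition unknotting_index (K : virtual_knot) : nat -> nat -> Prop :=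
  is_lex_min (fun m n =>
    exists2 D, presents D K & diagram_unknotting_index D m n).

(** * Groups given by generators and relations *)

Section Presentation.
Variable X : choiceType.

(* [(x, true)] is the letter x and [(x, false)] the letter x^-1. *)
Definition word := seq (X * bool).

Variable R : word -> word -> Prop.

Inductive word_step : word -> word -> Prop :=
| WordCancel u v x b : word_step (u ++ [:: (x, b); (x, ~~ b)] ++ v) (u ++ v)
| WordRel u v l r : R l r -> word_step (u ++ l ++ v) (u ++ r ++ v).

Definition word_eq : word -> word -> Prop :=
  clos_refl_sym_trans word word_step.
Definition word_eqb : rel word := fun u v => `[< word_eq u v >].

Lemma word_eqb_refl : reflexive word_eqb.
Proof. by move=> u; apply/asboolP/rst_refl. Qed.
Lemma word_eqb_sym : symmetric word_eqb.
Proof. by move=> u v; apply/asboolP/asboolP; apply: rst_sym. Qed.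
Lemma word_eqb_trans : transitive word_eqb.
Proof. by move=> v u x /asboolP uv /asboolP vx; apply/asboolP; exact: rst_trans uv vx. Qed.
Canonical word_equiv :=
  EquivRel word_eqb word_eqb_refl word_eqb_sym word_eqb_trans.

Definition presented := {eq_quot word_equiv}.
HB.instance Definition _ := Choice.on presented.
HB.instance Definition _ := EqQuotient.on presented.

Lemma presentedP u v : \pi_presented u = \pi_presented v <-> word_eq u v.
Proof. by split=> [/eqmodP/asboolP|uv]; last apply/eqmodP/asboolP. Qed.

Definition inv_word (u : word) : word := [seq (a.1, ~~ a.2) | a <- rev u].

Definition presented_one : presented := \pi_presented [::].
Definition presented_mul (x y : presented) : presented :=
  \pi_presented (repr x ++ repr y).
Definition presented_inv (x : presented) : presented :=
  \pi_presented (inv_word (repr x)).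

Lemma word_eq_ctx a b u v : word_eq u v -> word_eq (a ++ u ++ b) (a ++ v ++ b).
Proof.
elim=> [{}u {}v []||{}u {}v _|{}u x {}v _ ux _ xv].
- move=> s t x c; rewrite -!catA !(catA a); apply: rst_step.
  exact: (WordCancel (a ++ s) (t ++ b)).
- move=> s t l r lr; rewrite -!catA !(catA a); apply: rst_step.
  exact: (WordRel (a ++ s) (t ++ b) lr).
- by move=> ?; apply: rst_refl.
- exact: rst_sym.
- exact: rst_trans ux xv.
Qed.

Lemma word_eq_cat u u' v v' :
  word_eq u u' -> word_eq v v' -> word_eq (u ++ v) (u' ++ v').
Proof.
move=> uu' vv'; apply: (@rst_trans _ _ _ (u' ++ v)).
  exact: (@word_eq_ctx [::] v).
by have := @word_eq_ctx u' [::] _ _ vv'; rewrite !cats0.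
Qed.

Lemma word_eq_invr u : word_eq (u ++ inv_word u) [::].
Proof.
elim/last_ind: u => [|u [x b] IHu]; first exact: rst_refl.
apply: rst_trans IHu; rewrite /inv_word rev_rcons /= -cats1 -catA /=.
exact/rst_step/(WordCancel u).
Qed.

Lemma inv_wordK : involutive inv_word.
Proof.
move=> u; rewrite /inv_word -map_rev revK -map_comp -[RHS]map_id.
by apply: eq_map => -[x b] /=; rewrite negbK.
Qed.

Lemma word_eq_invl u : word_eq (inv_word u ++ u) [::].
Proof. by rewrite -{2}(inv_wordK u); apply: word_eq_invr. Qed.

Lemma word_eq_inv u v : word_eq u v -> word_eq (inv_word u) (inv_word v).
Proof.
move=> uv; apply: (@rst_trans _ _ _ (inv_word u ++ u ++ inv_word v)).
  rewrite -{1}(cats0 (inv_word u)).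
  apply: word_eq_cat; [exact: rst_refl | apply: rst_sym].
  apply: rst_trans (word_eq_invr v).
  by apply: word_eq_cat => //; apply: rst_refl.
rewrite catA; apply: (word_eq_cat (word_eq_invl u)); exact: rst_refl.
Qed.

Lemma word_eq_repr u : word_eq (repr (\pi_presented u)) u.
Proof. by apply/presentedP; rewrite reprK. Qed.

Lemma pi_word_cat u v :
  \pi_presented (u ++ v) = presented_mul (\pi_presented u) (\pi_presented v).
Proof.
by apply/presentedP/word_eq_cat; apply: rst_sym; apply: word_eq_repr.
Qed.

Lemma pi_word_inv u :
  \pi_presented (inv_word u) = presented_inv (\pi_presented u).
Proof. by apply/presentedP/word_eq_inv/rst_sym/word_eq_repr. Qed.

Lemma presented_mulA : associative presented_mul.
Proof.
elim/quotW=> u; elim/quotW=> v; elim/quotW=> w.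
by rewrite -(pi_word_cat v w) -(pi_word_cat u v) -!pi_word_cat catA.
Qed.
Lemma presented_mul1 : left_id presented_one presented_mul.
Proof. by elim/quotW=> u; rewrite -pi_word_cat. Qed.
Lemma presented_mulr1 : right_id presented_one presented_mul.
Proof. by elim/quotW=> u; rewrite -pi_word_cat cats0. Qed.
Lemma presented_mulV : left_inverse presented_one presented_inv presented_mul.
Proof.
elim/quotW=> u; rewrite -pi_word_inv -pi_word_cat.
exact/presentedP/word_eq_invl.
Qed.
Lemma presented_mulrV : right_inverse presented_one presented_inv presented_mul.
Proof.
elim/quotW=> u; rewrite -pi_word_inv -pi_word_cat.
exact/presentedP/word_eq_invr.
Qed.
HB.instance Definition _ := isGroup.Build presented
  presented_mulA presented_mul1 presented_mulr1 presented_mulV presented_mulrV.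

Definition gen (x : X) : presented := \pi_presented [:: (x, true)].

End Presentation.

(** * Wirtinger group *)

Section Wirtinger.
Variable D : diagram.
Let w := visits D.

Definition n_under : nat := count (fun v => level v == Under) w.

(* There is one arc for each under visit, except that there is one arc if there
   is no real crossing; the arcs are numbered from the base point on. *)
Definition wirtinger_arc := 'I_n_under.-1.+1.

(* the arc which contains edge [k], which ends at visit [k] *)
Definition arc_at (k : nat) : wirtinger_arc :=
  inZp (count (fun v => level v == Under) (take k w)).

(* For an over visit [v], at position [j], the under strand enters its crossing
   by edge [k] and leaves it by edge [k + 1], where [k] is the position of the
   under visit [mate v]; the relation is z = y^-1 x y. *)
Inductive wirtinger_rel : word wirtinger_arc -> word wirtinger_arc -> Prop :=
| WirtingerRel v : v \in w -> level v = Over ->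
    let k := index (mate v) w in
    let y := arc_at (index v w) in
    let x := if leftward v then arc_at k.+1 else arc_at k in
    let z := if leftward v then arc_at k else arc_at k.+1 in
    wirtinger_rel [:: (z, true)] [:: (y, false); (x, true); (y, true)].

Definition wirtinger_group := presented wirtinger_rel.
HB.instance Definition _ := Group.on wirtinger_group.

Definition wirtinger_gen (a : wirtinger_arc) : wirtinger_group :=
  gen wirtinger_rel a.

End Wirtinger.

(** * Commutator subgroups *)

Section Derived.
Variable G : groupType.
Local Open Scope group_scope.

Definition generated (S : {pred G}) : {pred G} := fun x =>
  `[< forall H : {pred G}, group_closed H -> {subset S <= H} -> x \in H >].

Definition commutators (H : {pred G}) : {pred G} := fun x =>
  `[< exists2 a, a \in H & exists2 b, b \in H & x = [~ a, b] >].

Definition derived (H : {pred G}) : {pred G} := generated (commutators H).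

Lemma generated_closed S : group_closed (generated S).
Proof.
split=> [|x y /asboolP Hx /asboolP Hy]; apply/asboolP=> H gH sH.
  by case: gH.
by apply: gH.2; [apply: Hx | apply: Hy].
Qed.

Lemma derived_closed H : group_closed (derived H).
Proof. exact: generated_closed. Qed.

Lemma derived_comm (H : {pred G}) x y :
  x \in H -> y \in H -> [~ x, y] \in derived H.
Proof.
move=> Hx Hy; apply/asboolP=> K gK; apply; apply/asboolP.
by exists x => //; exists y.
Qed.

Lemma derived_conj (H : {pred G}) g :
    (forall x, x \in H -> x ^ g \in H) ->
  forall x, x \in derived H -> x ^ g \in derived H.
Proof.
move=> Hg x /asboolP/(_ [pred y | y ^ g \in derived H]); apply.
  split; first by rewrite inE conj1g; case: (derived_closed H).
  by move=> a b; rewrite !inE conjMg conjVg; apply: (derived_closed H).2.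
move=> _ /asboolP[a Ha [b Hb ->]]; rewrite inE conjRg.
by apply: derived_comm; apply: Hg.
Qed.

(* the commutator subgroup, as a group *)
Record commutator_subgroup := CommutatorSubgroup
  { dval :> G; _ : dval \in derived predT }.
HB.instance Definition _ := [isSub for dval].
HB.instance Definition _ := [Choice of commutator_subgroup by <:].
HB.instance Definition _ := SubChoice_isSubGroup.Build G _ commutator_subgroup
  (derived_closed predT).

End Derived.

(** * Laurent polynomials

   Z[t, t^-1] is the subring of the field of fractions of Z[t] which consists of
   the fractions p / t^n. *)

Local Open Scope ring_scope.
Local Notation "p %:F" := (@tofrac {poly int} p).

Definition laurent_pred : {pred {fraction {poly int}}} := fun f =>
  `[< exists p n, f = p%:F / ('X^n)%:F >].

Lemma tofracX_neq0 n : ('X^n)%:F != 0.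
Proof. by rewrite tofrac_eq0 -size_poly_eq0 size_polyXn. Qed.

Lemma laurent_closed : subring_closed laurent_pred.
Proof.
split.
- by apply/asboolP; exists 1, 0%N; rewrite expr0 tofrac1 divr1.
- move=> _ _ /asboolP[p [m ->]] /asboolP[q [n ->]]; apply/asboolP.
  exists (p * 'X^n - q * 'X^m), (m + n)%N.
  rewrite exprD tofracB !tofracM -mulNr.
  by rewrite addf_div ?tofracX_neq0 // mulNr.
- move=> _ _ /asboolP[p [m ->]] /asboolP[q [n ->]]; apply/asboolP.
  by exists (p * q), (m + n)%N; rewrite exprD !tofracM mulf_div.
Qed.

HB.instance Definition _ :=
  GRing.isSubringClosed.Build {fraction {poly int}} laurent_pred laurent_closed.

Record laurent := Laurent
  { lval :> {fraction {poly int}}; lvalP : lval \in laurent_pred }.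
HB.instance Definition _ := [isSub for lval].
HB.instance Definition _ := [Choice of laurent by <:].
HB.instance Definition _ := [SubChoice_isSubComNzRing of laurent by <:].

(** An abelian group with an automorphism is a Z[t, t^-1]-module. *)
Section LaurentAction.
Variables (V : zmodType) (f g : V -> V).
Hypotheses (fD : {morph f : x y / x + y}) (fK : cancel f g) (gK : cancel g f).
Implicit Types (p q : {poly int}) (u v : V) (a b : laurent).

(* p(f) applied to v *)
Definition poly_act (p : {poly int}) (v : V) : V :=
  \sum_(i < size p) iter i f v *~ p`_i.

Lemma laurent_num (a : laurent) :
  {pn : {poly int} * nat | lval a = pn.1%:F / ('X^(pn.2))%:F}.
Proof.
case: a => a /= /asboolP h; apply: cid.
by case: h => p [n ->]; exists (p, n).
Qed.

(* (p / t^n) v = t^-n (p(t) v) *)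
Definition laurent_act (a : laurent) (v : V) : V :=
  let: exist pn _ := laurent_num a in iter pn.2 g (poly_act pn.1 v).

Lemma poly_actE n p v : (size p <= n)%N ->
  poly_act p v = \sum_(i < n) iter i f v *~ p`_i.
Proof.
move=> le_pn; rewrite /poly_act (big_ord_widen n (fun i => iter i f v *~ p`_i)) //.
rewrite big_mkcond; apply: eq_bigr => i _; case: ltnP => // le_pi.
by rewrite nth_default.
Qed.

Lemma poly_actDl p q v : poly_act (p + q) v = poly_act p v + poly_act q v.
Proof.
pose n := maxn (size p) (size q).
rewrite !(@poly_actE n) ?leq_maxl ?leq_maxr ?size_polyD // -big_split.
by apply: eq_bigr => i _; rewrite coefD mulrzDr.
Qed.

Lemma iter_actD i : {morph iter i f : x y / x + y}.
Proof. by elim: i => // i IH x y; rewrite /= IH fD. Qed.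

Lemma poly_actDr p u v : poly_act p (u + v) = poly_act p u + poly_act p v.
Proof.
by rewrite -big_split; apply: eq_bigr => i _; rewrite iter_actD mulrzDl.
Qed.

Lemma poly_actC c v : poly_act c%:P v = v *~ c.
Proof. by rewrite (@poly_actE 1) ?size_polyC_leq1 // big_ord1 coefC. Qed.

Lemma poly_actMX p v : poly_act (p * 'X) v = poly_act p (f v).
Proof.
rewrite (@poly_actE (size p).+1); last first.
  by rewrite (leq_trans (size_polyMleq _ _)) // size_polyX addn2.
rewrite big_ord_recl coefMX mulr0z add0r; apply: eq_bigr => i _.
by rewrite coefMX /= -iterSr.
Qed.

Lemma fB : {morph f : x y / x - y}.
Proof. by move=> x y; apply: (addIr (f y)); rewrite -fD !subrK. Qed.
Lemma f0 : f 0 = 0.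
Proof. by apply: (addIr (f 0)); rewrite -fD !add0r. Qed.
Lemma fMn v n : f (v *+ n) = f v *+ n.
Proof. by elim: n => [|n IH]; rewrite ?mulr0n ?f0 // !mulrS fD IH. Qed.
Lemma fMz v c : f (v *~ c) = f v *~ c.
Proof.
have fN u : f (- u) = - f u by rewrite -sub0r fB f0 sub0r.
by case: c => n; rewrite ?NegzE ?mulrNz ?fN -!pmulrn fMn.
Qed.
Lemma f_sum n (F : 'I_n -> V) : f (\sum_i F i) = \sum_i f (F i).
Proof. exact: (big_morph f fD f0). Qed.

Lemma poly_act_f p v : poly_act p (f v) = f (poly_act p v).
Proof.
by rewrite f_sum; apply: eq_bigr => i _; rewrite fMz -iterS -iterSr.
Qed.

Lemma poly_act_iterf p n v : poly_act p (iter n f v) = iter n f (poly_act p v).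
Proof. by elim: n => //= n IH; rewrite poly_act_f IH. Qed.

Lemma poly_actM p q v : poly_act (p * q) v = poly_act p (poly_act q v).
Proof.
elim/poly_ind: p v => [|p c IH] v.
  by rewrite mul0r /poly_act size_poly0 !big_ord0.
rewrite mulrDl !poly_actDl -mulrA -commr_polyX mulrA poly_actMX IH.
rewrite poly_actMX poly_act_f poly_actC; congr (_ + _).
rewrite mul_polyC (@poly_actE (size q)); last first.
  exact: size_scale_leq.
rewrite /poly_act mulrz_suml; apply: eq_bigr => i _.
by rewrite coefZ mulrC mulrzA.
Qed.

Lemma poly_actXn n v : poly_act 'X^n v = iter n f v.
Proof.
elim: n v => [|n IH] v; first by rewrite expr0 -[1]/(1%:P) poly_actC mulr1z.
by rewrite exprSr poly_actMX IH -iterSr.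
Qed.

Lemma iterfK n : cancel (iter n f) (iter n g).
Proof. by elim: n => // n IH x; rewrite iterSr fK IH. Qed.
Lemma itergK n : cancel (iter n g) (iter n f).
Proof. by elim: n => // n IH x; rewrite iterSr gK IH. Qed.

Lemma laurent_actE a v p n :
  lval a = p%:F / ('X^n)%:F -> laurent_act a v = iter n g (poly_act p v).
Proof.
rewrite /laurent_act; case: laurent_num => -[q m] /= -> /eqP.
rewrite eqr_div ?tofracX_neq0 // -!tofracM tofrac_eq => /eqP e.
apply: (can_inj (iterfK (m + n)%N)); rewrite [in LHS]addnC !iterD !itergK.
by rewrite -!poly_actXn -!poly_actM mulrC e mulrC.
Qed.

Lemma poly_act_iterg p n v : poly_act p (iter n g v) = iter n g (poly_act p v).
Proof.
apply: (can_inj (iterfK n)); rewrite itergK -poly_actXn -poly_actM mulrC.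
by rewrite poly_actM poly_actXn itergK.
Qed.

Lemma laurent_act1 : left_id 1 laurent_act.
Proof.
move=> v; rewrite (@laurent_actE _ _ 1 0); first by rewrite poly_actC mulr1z.
by rewrite expr0 tofrac1 divr1.
Qed.

Lemma laurent_actA a b v :
  laurent_act a (laurent_act b v) = laurent_act (a * b) v.
Proof.
case: (laurent_num a) => -[p m] /= ea; case: (laurent_num b) => -[q n] /= eb.
rewrite (laurent_actE _ ea) (laurent_actE _ eb).
rewrite (@laurent_actE _ _ (p * q) (m + n)%N); last first.
  by rewrite /= ea eb exprD !tofracM mulf_div.
by rewrite poly_act_iterg poly_actM iterD.
Qed.

Lemma gD : {morph g : x y / x + y}.
Proof. by move=> x y; apply: (can_inj fK); rewrite fD !gK. Qed.

Lemma itergD i : {morph iter i g : x y / x + y}.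
Proof. by elim: i => // i IH x y; rewrite /= IH gD. Qed.

Lemma laurent_actDr : right_distributive laurent_act +%R.
Proof.
move=> a u v; case: (laurent_num a) => -[p m] /= ea.
by rewrite !(laurent_actE _ ea) poly_actDr itergD.
Qed.

Lemma laurent_actDl v : {morph laurent_act^~ v : a b / a + b}.
Proof.
move=> a b; case: (laurent_num a) => -[p m] /= ea.
case: (laurent_num b) => -[q n] /= eb.
rewrite (laurent_actE _ ea) (laurent_actE _ eb).
rewrite (@laurent_actE _ _ (p * 'X^n + q * 'X^m) (m + n)%N); last first.
  by rewrite /= ea eb addf_div ?tofracX_neq0 // exprD tofracD !tofracM.
rewrite poly_actDl !poly_actM !poly_actXn itergD; congr (_ + _).
  by rewrite iterD poly_act_iterf iterfK.
by rewrite addnC iterD poly_act_iterf iterfK.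
Qed.

End LaurentAction.

(** * The group G'/G'' *)

Section CommutatorModule.
Variable G : groupType.
Local Open Scope group_scope.

(* equality modulo G'' *)
Definition dcongr : rel (commutator_subgroup G) := fun x y =>
  (dval x)^-1 * dval y \in derived (derived (@predT G)).

Lemma derived1_conj (h x : G) :
  x \in derived predT -> x ^ h \in derived predT.
Proof. exact: derived_conj. Qed.

Lemma derived2_conj (h x : G) :
  x \in derived (derived predT) -> x ^ h \in derived (derived predT).
Proof. by apply: derived_conj => y; apply: derived1_conj. Qed.

Lemma dcongr_refl : reflexive dcongr.
Proof. by move=> x; rewrite /dcongr mulVg; case: (derived_closed (derived (@predT G))). Qed.

Lemma dcongr_sym : symmetric dcongr.
Proof.
suff h x y : dcongr x y -> dcongr y x by move=> x y; apply/idP/idP; apply: h.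
move=> /(group_closedV (derived_closed _)).
by rewrite invgM invgK.
Qed.

Lemma dcongr_trans : transitive dcongr.
Proof.
move=> y x z xy yz; have := group_closedM (derived_closed _) xy yz.
by rewrite -mulgA mulVKg.
Qed.

Canonical dcongr_equiv := EquivRel dcongr dcongr_refl dcongr_sym dcongr_trans.

Definition commutator_quotient := {eq_quot dcongr_equiv}.
HB.instance Definition _ := Choice.on commutator_quotient.
HB.instance Definition _ := EqQuotient.on commutator_quotient.

Local Notation M := commutator_quotient.

Lemma commutator_quotientP x y : \pi_M x = \pi_M y <-> dcongr x y.
Proof. by split=> [/eqmodP|xy]; last apply/eqmodP. Qed.

Definition cm_zero : M := \pi_M 1.
Definition cm_opp (x : M) : M := \pi_M (repr x)^-1.
Definition cm_add (x y : M) : M := \pi_M (repr x * repr y).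

Lemma dcongr_repr x : dcongr (repr (\pi_M x)) x.
Proof. by apply/commutator_quotientP; rewrite reprK. Qed.

Lemma dcongrM x x' y y' : dcongr x x' -> dcongr y y' -> dcongr (x * y) (x' * y').
Proof.
rewrite /dcongr => /(derived2_conj (dval y)) xx' yy'.
have := group_closedM (derived_closed _) xx' yy'.
by rewrite conjgE !valM invgM !mulgA mulgK.
Qed.

Lemma dcongrC x y : dcongr (x * y) (y * x).
Proof.
have := derived_comm (valP y) (valP x).
by rewrite /dcongr !valM invgM commgEl conjgE !mulgA.
Qed.

Lemma pi_mulg x y : \pi_M (x * y) = cm_add (\pi_M x) (\pi_M y).
Proof.
by apply/commutator_quotientP/dcongrM; rewrite dcongr_sym; apply: dcongr_repr.
Qed.

Lemma cm_addA : associative cm_add.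
Proof.
elim/quotW=> x; elim/quotW=> y; elim/quotW=> z.
by rewrite -(pi_mulg y z) -(pi_mulg x y) -!pi_mulg mulgA.
Qed.
Lemma cm_addC : commutative cm_add.
Proof.
elim/quotW=> x; elim/quotW=> y.
by rewrite -(pi_mulg x y) -(pi_mulg y x); apply/commutator_quotientP/dcongrC.
Qed.
Lemma cm_add0 : left_id cm_zero cm_add.
Proof. by elim/quotW=> x; rewrite -(pi_mulg 1 x) mul1g. Qed.
Lemma cm_addN : left_inverse cm_zero cm_opp cm_add.
Proof.
elim/quotW=> x.
by rewrite -{2}(reprK (\pi_M x)) -(pi_mulg (_^-1)) mulVg.
Qed.

HB.instance Definition _ := GRing.isZmodule.Build M cm_addA cm_addC cm_add0 cm_addN.

(* conjugation by [h], x |-> h^-1 x h, on G' and on G'/G'' *)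
Definition conj_sub (h : G) (x : commutator_subgroup G) :=
  CommutatorSubgroup (derived1_conj h (valP x)).
Definition conj_module (h : G) (x : M) : M := \pi_M (conj_sub h (repr x)).

Lemma conj_module_pi h x : conj_module h (\pi_M x) = \pi_M (conj_sub h x).
Proof.
apply/commutator_quotientP; rewrite /dcongr /= -conjVg -conjMg.
exact/derived2_conj/dcongr_repr.
Qed.

Lemma conj_moduleD h : {morph conj_module h : x y / (x + y)%R}.
Proof.
elim/quotW=> x; elim/quotW=> y; rewrite -[LHS]/(conj_module h (cm_add _ _)).
rewrite -(pi_mulg x y) !conj_module_pi -[RHS]/(cm_add _ _) -pi_mulg.
by congr (\pi_M _); apply: val_inj; rewrite /= conjMg.
Qed.

Lemma conj_moduleK h : cancel (conj_module h) (conj_module h^-1).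
Proof.
elim/quotW=> x; rewrite (conj_module_pi h x) conj_module_pi.
congr (\pi_M _); apply: val_inj; exact: conjgK.
Qed.

Lemma conj_moduleVK h : cancel (conj_module h^-1) (conj_module h).
Proof. by move=> x; rewrite -{1}(invgK h) conj_moduleK. Qed.

(* The Z[t, t^-1]-module G'/G'' in which t acts by conjugation by [h].  Its
   minimal number of generators is not affected by the replacement of t with
   t^-1, that is, by the choice between h^-1 x h and h x h^-1. *)
Definition commutator_module (h : G) : Type := M.
HB.instance Definition _ h := GRing.Zmodule.on (commutator_module h).
HB.instance Definition _ h :=
  GRing.Zmodule_isLmodule.Build laurent (commutator_module h)
  (laurent_actA (conj_moduleD h) (conj_moduleK h) (conj_moduleVK h))
  (laurent_act1 (conj_moduleD h) (conj_moduleK h) (conj_moduleVK h))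
  (laurent_actDr (conj_moduleD h) (conj_moduleK h) (conj_moduleVK h))
  (laurent_actDl (conj_moduleD h) (conj_moduleK h) (conj_moduleVK h)).

End CommutatorModule.

(* The virtual knot module of the knot presented by [D], for the action of the
   Wirtinger generator of the arc [a]. *)
Definition virtual_knot_module (D : diagram) (a : wirtinger_arc D) :
    lmodType laurent :=
  commutator_module (wirtinger_gen a).
Arguments virtual_knot_module : clear implicits.

Definition generates (M : lmodType laurent) (k : nat) (u : 'I_k -> M) : Prop :=
  forall x : M, exists c : 'I_k -> laurent, x = \sum_i c i *: u i.

(* [e(M) = k] *)
Definition min_generators (M : lmodType laurent) (k : nat) : Prop :=
  (exists u : 'I_k -> M, generates u) /\
  forall (l : nat) (u : 'I_l -> M), generates u -> (k <= l)%N.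

(* Main.v *)
Require Import Defs.
From Stdlib Require Import Relation_Operators.
From mathcomp Require Import all_boot all_algebra.
From mathcomp Require Import boolp zify.

(** Why e(M) is at most m + n.  Let D0 be a diagram of the knot on which
   virtualizing the m crossings of A and changing the n crossings of B gives a
   diagram D' of the trivial knot.

   Wirtinger relations are handled through colorings: a coloring of a diagram
   in a group H is a map from the arcs to H which satisfies the relation at each
   real crossing, that is, a homomorphism from the group of the diagram to H.
   Every move turns a coloring into another one which generates the same
   subgroup; the only half of this that matters is that each subgroup which
   contains the new colors contains the old ones ([transfers_equivalent]).

   Let G be the group of a diagram D of the knot.  The tautological coloring of
   D in G generates G ([coloring_wirtinger], [wirtinger_colors_in]), so D0 has
   a coloring in G which generates G as well.  For each crossing in A let r be
   x^-1 z, where x and z are the colors of the two under arcs, and for each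
   crossing in B let r be x^-1 y, where y is the color of the over arc.  All
   colors are conjugate, so these m + n elements lie in G'.

   Let N be any normal subgroup which contains them.  Modulo N the under strand
   keeps its color at the crossings of A, which may thus be virtual, and the two
   strands have the same color at the crossings of B, which may thus be
   changed: the coloring of D0 is a coloring of D' in G/N ([alter_coloring]).
   It can be transferred to a diagram without crossings, which has a single
   color, so G/N is commutative and N contains G' ([altered_commutators]).

   It remains to apply this to the subgroup N of the elements of G' whose class
   in M = G'/G'' is a linear combination of the classes of the r.  It is normal
   because G is normally generated by any Wirtinger generator a, which makes
   each element of G act on M as a power of t ([conj_module_scalar],
   [generates_of_abelian]). *)

Set Implicit Arguments.
Unset Strict Implicit.
Unset Printing Implicit Defensive.

Import GRing.Theory.
Local Open Scope group_scope.
Local Open Scope quotient_scope.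

(** * Colorings *)

Lemma conjgg (H : groupType) (p : H) : p ^ p = p.
Proof. by rewrite conjgE mulKg. Qed.

Lemma conjgVg (H : groupType) (p : H) : p ^ p^-1 = p.
Proof. by rewrite conjgE invgK mulgV mulg1. Qed.

Lemma closed_conj (H : groupType) (K : {pred H}) p q :
  group_closed K -> p \in K -> q \in K -> p ^ q \in K.
Proof.
move=> gK Kp Kq; rewrite conjgE.
by rewrite !(group_closedM gK) // (group_closedV gK).
Qed.

Section Colorings.
Variable H : groupType.
Implicit Types (o : nat -> H) (p q : H) (v : visit) (w : seq visit).
Implicit Types (K : {pred H}).

(** A coloring is given by the colors [o] of the over strands of the crossings,
   indexed by labels, and by the color [p] of the base point: the color of the
   other arcs is found by following the curve, and [cross o p v] is the color
   after the visit [v] when it is [p] before. *)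
Definition cross o p v : H :=
  if level v == Under then
    p ^ (if leftward v then o (label v) else (o (label v))^-1)
  else p.

Definition run o p w : H := foldl (cross o) p w.

Fixpoint compatible o p w : bool :=
  if w is v :: w' then
    ((level v == Over) ==> (p == o (label v))) && compatible o (cross o p v) w'
  else true.

Definition coloring o p w : bool := compatible o p w && (run o p w == p).

(** The subgroup [K] contains all the colors.  Each color is a conjugate of [p]
   by colors of over strands, so only these have to be mentioned
   ([colors_in_run]). *)
Definition colors_in K o p w : Prop :=
  p \in K /\ {in w, forall v, level v != Virtual -> o (label v) \in K}.

Lemma run_cat o p w w' : run o p (w ++ w') = run o (run o p w) w'.
Proof. exact: foldl_cat. Qed.

Lemma compatible_cat o p w w' :
  compatible o p (w ++ w') = compatible o p w && compatible o (run o p w) w'.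
Proof. by elim: w p => //= v w IH p; rewrite IH andbA. Qed.

Lemma compatibleP o p w :
  reflect (forall w1 v w2, w = w1 ++ v :: w2 -> level v = Over ->
             run o p w1 = o (label v)) (compatible o p w).
Proof.
elim: w p => [|u w IH] p /=; first by constructor; case.
apply: (iffP andP) => [[up /IH{}IH] [|u' w1] v w2 /= [<-] e lv|h].
- by apply/eqP; apply: (implyP up); apply/eqP.
- exact: (IH w1 v w2).
split; first by apply/implyP => /eqP lu; apply/eqP; apply: (h [::]).
by apply/IH => w1 v w2 e lv; rewrite -(h (u :: w1) v w2) //= e.
Qed.

Lemma eq_run o o' p w :
  {in w, forall v, o (label v) = o' (label v)} -> run o p w = run o' p w.
Proof.
elim: w p => //= v w IH p eq_o; rewrite /cross eq_o ?mem_head // IH // => u uw.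
by rewrite eq_o // inE uw orbT.
Qed.

Lemma eq_compatible o o' p w :
    {in w, forall v, o (label v) = o' (label v)} ->
  compatible o p w = compatible o' p w.
Proof.
elim: w p => //= v w IH p eq_o; rewrite /cross eq_o ?mem_head // IH // => u uw.
by rewrite eq_o // inE uw orbT.
Qed.

Lemma eq_colors_in K o o' p w :
    {in w, forall v, o (label v) = o' (label v)} ->
  colors_in K o p w -> colors_in K o' p w.
Proof. by move=> eq_o [Kp Ko]; split=> // v vw; rewrite -eq_o //; apply: Ko. Qed.

Lemma run_conj o p w : exists g, run o p w = p ^ g.
Proof.
elim: w p => [|v w IH] p /=; first by exists 1; rewrite conjg1.
have [g ->] := IH (cross o p v); rewrite /cross; case: eqP => _; last by exists g.
by rewrite -conjgM; eexists.
Qed.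

Lemma run_ratio_derived o p w1 w2 :
  (run o p w1)^-1 * run o p w2 \in derived predT.
Proof.
have [g ->] := run_conj o p w1; have [k ->] := run_conj o p w2.
have -> : p ^ k = (p ^ g) ^ (g^-1 * k) by rewrite -conjgM mulVKg.
by rewrite -commgEl; apply: derived_comm.
Qed.

Lemma colors_in_run K o p w :
  group_closed K -> colors_in K o p w -> run o p w \in K.
Proof.
move=> gK []; elim: w p => //= v w IH p Kp Ko; apply: IH => [|u uw].
  rewrite /cross; case: eqP => // lv; apply: closed_conj => //.
  have Kv : o (label v) \in K by rewrite Ko ?mem_head ?lv.
  by case: ifP => // _; rewrite (group_closedV gK).
by apply: Ko; rewrite inE uw orbT.
Qed.

Lemma colors_in_cat K o p w w' : group_closed K ->
  colors_in K o p (w ++ w') <->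
  colors_in K o p w /\ colors_in K o (run o p w) w'.
Proof.
move=> gK; split=> [[Kp Ko]|[Kw [_ Kw']]].
  have Kw : colors_in K o p w.
    by split=> // v vw; apply: Ko; rewrite mem_cat vw.
  split=> //; split=> [|v vw]; first exact: colors_in_run.
  by apply: Ko; rewrite mem_cat vw orbT.
split=> [|v]; first by case: Kw.
by rewrite mem_cat => /orP[/Kw.2|/Kw'].
Qed.

Lemma colors_in_nil K o p : colors_in K o p [::] <-> p \in K.
Proof. by split=> [[]|]. Qed.

(** ** Transfer of colorings *)

(** The new coloring may have another color at the base point, since a move may
   change the base point. *)
Definition transfers c d : Prop :=
  forall o p, coloring o p c -> exists o' p',
    coloring o' p' d /\
    forall K, group_closed K -> colors_in K o' p' d -> colors_in K o p c.

Lemma transfers_refl c : transfers c c.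
Proof. by move=> o p cop; exists o, p. Qed.

Lemma transfers_trans c d e : transfers c d -> transfers d e -> transfers c e.
Proof.
move=> cd de o p /cd[o' [p' [/de[o'' [p'' [e'' Ke]]] Kd]]].
by exists o'', p''; split=> // K gK /Ke; auto.
Qed.

Lemma transfers_rot c d : transfers (c ++ d) (d ++ c).
Proof.
move=> o p; rewrite /coloring compatible_cat run_cat.
move=> /andP[/andP[Cc Cd] /eqP e].
exists o, (run o p c); split=> [|K gK].
  by rewrite compatible_cat Cd run_cat e Cc eqxx.
move=> /(colors_in_cat _ _ _ _ gK)[Kd]; rewrite e => Kc.
by apply/colors_in_cat; rewrite ?e.
Qed.

Definition rename (r : nat -> nat) w :=
  [seq Visit (r (label v)) (leftward v) (level v) | v <- w].

Lemma run_rename r o p w : run o p (rename r w) = run (o \o r) p w.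
Proof. by elim: w p => //= v w IH p; rewrite -IH. Qed.

Lemma compatible_rename r o p w :
  compatible o p (rename r w) = compatible (o \o r) p w.
Proof. by elim: w p => //= v w IH p; rewrite -IH. Qed.

Lemma colors_in_rename K r o p w :
  colors_in K o p (rename r w) <-> colors_in K (o \o r) p w.
Proof.
split=> -[Kp Ko]; split=> // v.
  move=> vw; apply: (Ko (Visit (r (label v)) (leftward v) (level v))).
  exact: map_f.
by case/mapP=> u uw -> /=; apply: (Ko u).
Qed.

Lemma transfers_rename r w : injective r -> transfers w (rename r w).
Proof.
move=> r_inj o p cop.
pose o' n :=
  if pselect (exists l, r l = n) is left h then o (sval (cid h)) else 1.
have eo : o' \o r =1 o.
  move=> l; rewrite /o' /=; case: pselect => [h|[]]; last by exists l.
  by case: (cid h) => l' /= /r_inj ->.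
exists o', p; split=> [|K gK /colors_in_rename].
  rewrite /coloring compatible_rename run_rename.
  by rewrite (@eq_compatible _ o) ?(@eq_run _ o).
exact: eq_colors_in.
Qed.

Lemma transfers_unrename r w : transfers (rename r w) w.
Proof.
move=> o p; rewrite /coloring compatible_rename run_rename => cop.
by exists (o \o r), p; split=> // K gK Ks; apply/colors_in_rename.
Qed.

(** ** Local moves *)

Definition free_of (L : seq nat) w : Prop :=
  {in w, forall v, label v \notin L}.

(** A Reidemeister move replaces pieces of at most three strands: [s1], [s2],
   [s3] become [t1], [t2], [t3].  A coloring extends to the new diagram when
   it can be modified at the labels [L] of the move so that each strand enters
   and leaves the picture with the same colors as before.  The last condition
   says that no color inside the old picture is lost: they all lie in the
   subgroup generated by the incoming ones. *)
Definition local_transfer (L : seq nat) (s1 s2 s3 t1 t2 t3 : seq visit) : Prop :=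
  forall o p1 p2 p3,
    compatible o p1 s1 -> compatible o p2 s2 -> compatible o p3 s3 ->
  exists o', [/\ forall l, l \notin L -> o' l = o l,
    [/\ compatible o' p1 t1, compatible o' p2 t2 & compatible o' p3 t3],
    [/\ run o' p1 t1 = run o p1 s1, run o' p2 t2 = run o p2 s2
       & run o' p3 t3 = run o p3 s3]
  & forall K, group_closed K -> p1 \in K -> p2 \in K -> p3 \in K ->
      [/\ colors_in K o p1 s1, colors_in K o p2 s2 & colors_in K o p3 s3]].

Lemma transfers_local L w0 w1 w2 w3 s1 s2 s3 t1 t2 t3 :
    free_of L w0 -> free_of L w1 -> free_of L w2 -> free_of L w3 ->
    local_transfer L s1 s2 s3 t1 t2 t3 ->
  transfers (w0 ++ s1 ++ w1 ++ s2 ++ w2 ++ s3 ++ w3)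
            (w0 ++ t1 ++ w1 ++ t2 ++ w2 ++ t3 ++ w3).
Proof.
move=> F0 F1 F2 F3 loc o p; rewrite /coloring !compatible_cat !run_cat.
move=> /andP[/and5P[C0 C1 C2 C3 /and3P[C4 C5 C6]] R].
have [o' [eo [C1' C3' C5'] [R1 R3 R5] Ks]] := loc _ _ _ _ C1 C3 C5.
have e w : free_of L w -> {in w, forall v, o' (label v) = o (label v)}.
  by move=> Fw v /Fw/eo.
exists o', p; split=> [|K gK].
  rewrite !compatible_cat !run_cat.
  rewrite !(eq_run _ (e _ F0), R1, eq_run _ (e _ F1), R3, eq_run _ (e _ F2), R5).
  rewrite !(eq_run _ (e _ F3)) R C1' C3' C5'.
  rewrite !(eq_compatible _ (e _ F0)) !(eq_compatible _ (e _ F1)).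
  rewrite !(eq_compatible _ (e _ F2)) !(eq_compatible _ (e _ F3)).
  by rewrite C0 C2 C4 C6.
move=> /(colors_in_cat _ _ _ _ gK)[K0] /(colors_in_cat _ _ _ _ gK)[K1].
move=> /(colors_in_cat _ _ _ _ gK)[K2] /(colors_in_cat _ _ _ _ gK)[K3].
move=> /(colors_in_cat _ _ _ _ gK)[K4] /(colors_in_cat _ _ _ _ gK)[K5 K6].
move: K1 K2 K3 K4 K5 K6.
rewrite !(eq_run _ (e _ F0), R1, eq_run _ (e _ F1), R3, eq_run _ (e _ F2), R5).
move=> K1 K2 K3 K4 K5 K6.
have [K1' K3' K5'] := Ks K gK K1.1 K3.1 K5.1.
have up w p' (Fw : free_of L w) : colors_in K o' p' w -> colors_in K o p' w.
  exact/eq_colors_in/e.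
apply/(colors_in_cat _ _ _ _ gK); split; first exact: up.
apply/(colors_in_cat _ _ _ _ gK); split=> //.
apply/(colors_in_cat _ _ _ _ gK); split; first exact: up.
apply/(colors_in_cat _ _ _ _ gK); split=> //.
apply/(colors_in_cat _ _ _ _ gK); split; first exact: up.
apply/(colors_in_cat _ _ _ _ gK); split=> //.
exact: up.
Qed.

Definition recolor o l p := fun k => if k == l then p else o k.

(** At a curl the over strand is the under strand: the two arcs have the same
   color because conjugating a color by itself does nothing. *)
Lemma loop_color o p v : level v != Virtual ->
  compatible o p [:: v; mate v] -> o (label v) = p.
Proof.
case: v => l b [] //= _; rewrite /cross /= ?andbT => /eqP //.
by case: b => e; apply: (conjg_inj _ (etrans _ (esym e)));
  rewrite ?conjgg ?conjgVg.
Qed.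

Lemma local_loop v :
  local_transfer [:: label v] [::] [::] [::] [:: v; mate v] [::] [::].
Proof.
move=> o p1 p2 p3 _ _ _; exists (recolor o (label v) p1); split.
- by move=> l; rewrite inE /recolor => /negbTE->.
- split=> //; case: v => l b []; rewrite /= /cross /recolor /= ?eqxx //=.
  by case: b; rewrite ?conjgg ?conjgVg eqxx.
- split=> //; case: v => l b []; rewrite /run /= /cross /recolor /= ?eqxx //=;
  by case: b; rewrite ?conjgg ?conjgVg.
- by move=> K gK Kp K2 K3; split; apply/colors_in_nil.
Qed.

Lemma local_unloop v :
  local_transfer [:: label v] [:: v; mate v] [::] [::] [::] [::] [::].
Proof.
move=> o p1 p2 p3 C _ _; exists o; have col := loop_color _ C; split=> //.
- split=> //; move: col; case: v {C} => l b [] /= col //;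
  rewrite /run /= /cross /= -?(col isT); by case: b; rewrite ?conjgg ?conjgVg.
- move=> K gK Kp ? ?; split=> //; split=> // u uv lu.
  rewrite -(_ : label v = label u); last first.
    by move: uv; rewrite !inE => /orP[]/eqP->.
  rewrite col //.
  by move: uv lu; rewrite !inE => /orP[]/eqP-> //=; case: (level v).
Qed.

(** The over strand has one color in the bigon and crosses the under strand in
   opposite directions, so that the two conjugations cancel. *)
Lemma local_bigon u v f :
    leftward u != leftward v -> level u = level v -> label u != label v ->
  local_transfer [:: label u; label v] [::] [::] [::]
    [:: u; v] (ordered f (mate u) (mate v)) [::].
Proof.
move=> lr lev luv o p1 p2 p3 _ _ _.
pose q := if level u == Over then p1 else p2.
exists (recolor (recolor o (label u) q) (label v) q); split.
- by move=> l; rewrite !inE negb_or /recolor => /andP[/negbTE-> /negbTE->].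
- move: lr lev luv @q; case: u v f => [lu bu au] [lv bv av] [] /= lr + /negbTE luv;
  move: lr; case: bu; case: bv; case: au => //; case: av => //= _ _;
  by rewrite /cross /recolor /= ?eqxx ?(eq_sym lv) ?luv //= ?conjgK ?conjgKV ?eqxx.
- move: lr lev luv @q; case: u v f => [lu bu au] [lv bv av] [] /= lr + /negbTE luv;
  move: lr; case: bu; case: bv; case: au => //; case: av => //= _ _;
  by rewrite /run /= /cross /recolor /= ?eqxx ?(eq_sym lv) ?luv //= ?conjgK ?conjgKV.
- by move=> K gK K1 K2 K3; split; apply/colors_in_nil.
Qed.

Lemma local_unbigon u v f :
    leftward u != leftward v -> level u = level v ->
  local_transfer [:: label u; label v]
    [:: u; v] (ordered f (mate u) (mate v)) [::] [::] [::] [::].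
Proof.
move=> lr lev o p1 p2 p3 C1 C2 _; exists o.
have [col r1 r2] :
  [/\ level u != Virtual ->
        (o (label u) \in [:: p1; p2]) && (o (label v) \in [:: p1; p2]),
      run o p1 [:: u; v] = p1 & run o p2 (ordered f (mate u) (mate v)) = p2].
  move: C1 C2; case: u v f lr lev => [lu bu au] [lv bv av] [] /= lr;
  move: lr; case: bu; case: bv; case: au => //; case: av => //= _ _;
  rewrite /run /cross /= ?andbT;
  do ?[move=> /andP[/eqP e1 /eqP e2]|move=> _]; try rewrite -e1 -e2;
  by rewrite ?inE ?eqxx ?orbT /= ?conjgK ?conjgKV.
split=> // K gK K1 K2 K3.
have Kuv : level u != Virtual -> (o (label u) \in K) && (o (label v) \in K).
  by move/col; rewrite !inE => /andP[/orP[]/eqP-> /orP[]/eqP->]; rewrite ?K1 ?K2.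
split; last exact/colors_in_nil.
  by split=> // x; rewrite !inE => /orP[]/eqP->; rewrite -?lev => /Kuv/andP[].
split=> // x xf; suff : x \in [:: mate u; mate v].
  rewrite !inE => /orP[]/eqP->;
  by case: (u) (v) lev Kuv => [? ? []] [? ? []] //= _ /(_ isT) /andP[].
by move: xf; case: (f); rewrite // !inE orbC.
Qed.

(** Of the three crossings of a triangle, only the one between the middle and
   the bottom strands changes the color of its over arc: the side of the top
   strand on which it lies changes.  Its new color is that of the middle
   strand at this crossing in the new order of visits. *)
Definition triangle_recolor o p1 p2 p3 x y z (f1 f2 f3 : bool) :=
  match level x, level y, level z with
  | Over, Over, Over =>
      recolor o (label z) (if f2 then p2 else cross o p2 (mate x))
  | Over, Over, Under =>
      recolor o (label z) (if f3 then p3 else cross o p3 (mate y))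
  | Over, Under, Under =>
      recolor o (label x) (if f1 then cross o p1 y else p1)
  | Under, Over, Over =>
      recolor o (label y) (if f1 then p1 else cross o p1 x)
  | Under, Under, Over =>
      recolor o (label y) (if f3 then cross o p3 (mate z) else p3)
  | Under, Under, Under =>
      recolor o (label x) (if f2 then cross o p2 z else p2)
  | _, _, _ => o
  end.

Ltac group_eq := rewrite ?conjgE ?invgM ?invgK ?mulgA
  ?(mulgK, mulgVK, mulVg, mulgV, mul1g, mulg1).
Ltac in_closed gK :=
  do ?[exact gK | assumption | apply: closed_conj | rewrite (group_closedV gK)].

(** The top strand, of color t, has no under visit.  The bottom strand leaves
   with the same color because passing first under the middle strand of color m
   and then under t amounts to passing first under t and then under the middle
   strand behind t, whose color is m ^ t: (b ^ m) ^ t = (b ^ t) ^ (m ^ t),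
   and likewise with inverses.  When two crossings are virtual, no strand
   makes two real visits. *)
Lemma local_triangle x y z f1 f2 f3 :
    leftward x (+) leftward y = f2 (+) f3 ->
    leftward x (+) leftward z = f1 (+) f3 ->
    triangle_levels (level x) (level y) (level z) ->
    uniq [:: label x; label y; label z] ->
  local_transfer [:: label x; label y; label z]
    (ordered f1 x y) (ordered f2 (mate x) z) (ordered f3 (mate y) (mate z))
    (ordered (~~ f1) x y) (ordered (~~ f2) (mate x) z)
    (ordered (~~ f3) (mate y) (mate z)).
Proof.
move=> e1 e2.
have {e1 e2}[] : leftward y = leftward x (+) f2 (+) f3 /\
                 leftward z = leftward x (+) f1 (+) f3.
  move: e1 e2; move: (leftward x) (leftward y) (leftward z) f1 f2 f3.
  by do 6!case.
case: x y z => [lx b ax] [ly by_ ay] [lz bz az] /= -> ->.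
move=> lev uq o p1 p2 p3 C1 C2 C3.
have [lxy lxz lyz] : [/\ (lx == ly) = false, (lx == lz) = false
                       & (ly == lz) = false].
  move: uq; rewrite /= !inE negb_or andbT.
  by move=> /andP[/andP[/negbTE-> /negbTE->] /negbTE->].
have lE := (lxy, lxz, lyz, etrans (eq_sym _ _) lxy, etrans (eq_sym _ _) lxz,
            etrans (eq_sym _ _) lyz, eqxx).
exists (triangle_recolor o p1 p2 p3 (Visit lx b ax)
  (Visit ly (b (+) f2 (+) f3) ay) (Visit lz (b (+) f1 (+) f3) az) f1 f2 f3).
rewrite /triangle_recolor /=; split.
- move=> l; rewrite !inE !negb_or => /and3P[/negbTE h1 /negbTE h2 /negbTE h3].
  by case: ax ay az {lev C1 C2 C3} => [] [] [] //; rewrite /recolor ?h1 ?h2 ?h3.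
- move: C1 C2 C3; case: ax ay az lev => [] [] [] // _;
  case: f1 f2 f3 => [] [] [] /=;
  rewrite /run /cross /recolor /= ?andbT ?lE /=;
  do ?[move=> /andP[]|move=> /eqP <-|move=> _]; rewrite ?eqxx //;
  case: b => /=; split=> //; apply/eqP; by group_eq.
- move: C1 C2 C3; case: ax ay az lev => [] [] [] // _;
  case: f1 f2 f3 => [] [] [] /=;
  rewrite /run /cross /recolor /= ?andbT ?lE /=;
  do ?[move=> /andP[]|move=> /eqP <-|move=> _]; case: b => /=; split=> //;
  by group_eq.
- move=> K gK K1 K2 K3.
  have [kx ky kz] : [/\ ax != Virtual -> o lx \in K,
      ay != Virtual -> o ly \in K & az != Virtual -> o lz \in K].
    move: C1 C2 C3; case: ax ay az lev => [] [] [] // _;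
    case: f1 f2 f3 => [] [] [] /=;
    rewrite /cross /= ?andbT;
    do ?[move=> /andP[]|move=> /eqP <-|move=> _]; case: b => /=; split=> // _;
    by in_closed gK.
  have flipV a : (flip a != Virtual) = (a != Virtual) by case: a.
  by split; split=> // v; case: (f1) (f2) (f3) => [] [] [];
    rewrite !inE => /orP[]/eqP->; rewrite /= ?flipV.
Qed.

End Colorings.

(** * Visits of a Gauss code *)

Lemma well_formed_count w v :
  well_formed w -> v \in w -> count (fun u => label u == label v) w = 2.
Proof. by move=> /allP h /h/andP[_ /eqP]. Qed.

Lemma crossing_visits w v : well_formed w -> v \in w ->
  perm_eq [seq u <- w | label u == label v] [:: v; mate v].
Proof.
move=> wf vw; have := well_formed_count wf vw; rewrite -size_filter.
have : v \in [seq u <- w | label u == label v] by rewrite mem_filter eqxx.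
have : mate v \in [seq u <- w | label u == label v].
  by rewrite mem_filter eqxx; case/andP: (allP wf v vw).
have nv : (mate v == v) = false by apply/eqP; case: (v) => l [] a [].
case: [seq _ <- _ | _] => [|a [|b []]] //; rewrite !inE => m1 m2 _.
case/orP: m1 m2 nv => /eqP-> /orP[]/eqP->; rewrite ?eqxx // => _.
by apply/permP=> c /=; rewrite addnCA.
Qed.

Lemma well_formed_uniq w : well_formed w -> uniq w.
Proof.
move=> wf; apply: count_mem_uniq => v.
case: (boolP (v \in w)) => [vw|/count_memPn//].
have := permP (crossing_visits wf vw) (pred1 v); rewrite count_filter /= eqxx.
have -> : (mate v == v) = false by apply/eqP; case: (v) => l [] a [].
move=> e; apply: etrans e; apply: eq_count => u /=.
by case: eqP => // ->; rewrite eqxx.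
Qed.

Lemma visit_unique w u v : well_formed w -> u \in w -> v \in w ->
  level u = level v -> level v != Virtual -> label u = label v -> u = v.
Proof.
move=> wf uw vw luv lv euv; have := perm_mem (crossing_visits wf vw) u.
rewrite mem_filter euv eqxx uw /= !inE => /esym/orP[]/eqP // e.
by move: luv lv; rewrite e /=; case: (level v).
Qed.

Lemma index_split (w1 w2 : seq visit) v :
  uniq (w1 ++ v :: w2) -> index v (w1 ++ v :: w2) = size w1.
Proof.
rewrite cat_uniq index_cat /= negb_or => /and3P[_ /andP[/negbTE-> _] _].
by rewrite eqxx addn0.
Qed.

Lemma under_split_unique w1 u w2 w1' v w2' :
    well_formed (w1 ++ u :: w2) -> w1 ++ u :: w2 = w1' ++ v :: w2' ->
    level u = Under -> level v = Under -> label u = label v ->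
  u = v /\ w1 = w1'.
Proof.
move=> wf e lu lv luv; have uv : u = v.
  apply: (visit_unique wf); rewrite ?lu ?lv //; last rewrite e;
  by rewrite mem_cat mem_head orbT.
split=> //; have ew := index_split (well_formed_uniq wf).
have ew' : index v (w1' ++ v :: w2') = size w1'.
  by apply: index_split; rewrite -e; apply: well_formed_uniq.
rewrite uv in e ew; have := congr1 (take (size w1)) e.
by rewrite take_size_cat // -ew e ew' take_size_cat.
Qed.

Lemma visits_wf (D : diagram) : well_formed (visits D).
Proof. by case/andP: (valP D). Qed.

Lemma over_color_run (H : groupType) (o : nat -> H) p w v : well_formed w ->
    compatible o p w -> v \in w -> level v != Virtual ->
  exists w1 w2, w = w1 ++ w2 /\ o (label v) = run o p w1.
Proof.
move=> wf /compatibleP C vw.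
wlog lv : v vw / level v = Over.
  move=> hw; have [mw _] := andP (allP wf v vw).
  by case lv : (level v) => // _; [apply: (hw v) | apply: (hw (mate v))];
    rewrite //= lv.
case/splitPr: vw C => w1 w2 C _; exists w1, (v :: w2); split=> //.
by rewrite (C _ _ _ erefl lv).
Qed.

(** * Invariance under the moves *)

Section Invariance.
Variable H : groupType.

Lemma count_free l w : count (fun v => label v == l) w = 0 -> free_of [:: l] w.
Proof.
move/eqP; rewrite -leqn0 leqNgt -has_count => /hasPn h v /h.
by rewrite inE.
Qed.

Lemma free_cons l L w : free_of [:: l] w -> free_of L w -> free_of (l :: L) w.
Proof.
by move=> fl fL v vw; rewrite inE negb_or fL // andbT; have := fl v vw; rewrite inE.
Qed.

Lemma count_ordered (a : pred visit) f u v : count a (ordered f u v) = a u + a v.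
Proof. by case: f; rewrite /= addn0 // addnC. Qed.

Lemma mem_ordered f u v : ordered f u v =i [:: u; v].
Proof. by case: f => // x; rewrite !inE orbC. Qed.

Lemma transfers_loop w0 w1 v :
  well_formed (w0 ++ [:: v; mate v] ++ w1) ->
  transfers H (w0 ++ w1) (w0 ++ [:: v; mate v] ++ w1) /\
  transfers H (w0 ++ [:: v; mate v] ++ w1) (w0 ++ w1).
Proof.
move=> wf; have /(well_formed_count wf) : v \in w0 ++ [:: v; mate v] ++ w1.
  by rewrite mem_cat mem_head orbT.
rewrite !count_cat /= eqxx => cnt.
have f0 : free_of [:: label v] w0 by apply: count_free; lia.
have f1 : free_of [:: label v] w1 by apply: count_free; lia.
have fn : free_of [:: label v] [::] by [].
split; [have := transfers_local f0 f1 fn fn (@local_loop H v)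
  | have := transfers_local f0 f1 fn fn (@local_unloop H v)]; by rewrite !cats0.
Qed.

Lemma transfers_bigon w0 w1 w2 u v f :
    leftward u != leftward v -> level u = level v ->
  well_formed (w0 ++ [:: u; v] ++ w1 ++ ordered f (mate u) (mate v) ++ w2) ->
  transfers H (w0 ++ w1 ++ w2)
     (w0 ++ [:: u; v] ++ w1 ++ ordered f (mate u) (mate v) ++ w2) /\
  transfers H (w0 ++ [:: u; v] ++ w1 ++ ordered f (mate u) (mate v) ++ w2)
     (w0 ++ w1 ++ w2).
Proof.
move=> lr lev; set w := (X in well_formed X) => wf.
pose c x := count (fun y => label y == label x).
have cnt x : x \in [:: u; v] ->
    c x w0 + c x w1 + c x w2
      + 2 * ((label u == label x) + (label v == label x)) = 2.
  move=> xuv; have xw : x \in w by rewrite /w !mem_cat xuv orbT.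
  have := well_formed_count wf xw.
  by rewrite /c /w !count_cat count_ordered /=; lia.
have cu := cnt u; have cv := cnt v.
rewrite !inE !eqxx ?orbT /= in cu cv.
move: (cu isT) (cv isT) => {cu cv} cu cv.
have luv : label u != label v by rewrite eq_sym; lia.
have [f0 f1 f2] : [/\ free_of [:: label u; label v] w0,
    free_of [:: label u; label v] w1 & free_of [:: label u; label v] w2].
  by split; do !apply: free_cons => //; apply: count_free; rewrite -/(c _ _); lia.
have fn : free_of [:: label u; label v] [::] by [].
split; [have := transfers_local f0 f1 f2 fn (@local_bigon H _ _ f lr lev luv)
  | have := transfers_local f0 f1 f2 fn (@local_unbigon H _ _ f lr lev)];
  by rewrite !cats0.
Qed.

Lemma triangle_labels w0 w1 w2 w3 x y z f1 f2 f3 :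
    well_formed (w0 ++ ordered f1 x y ++ w1 ++ ordered f2 (mate x) z ++ w2
      ++ ordered f3 (mate y) (mate z) ++ w3) ->
  uniq [:: label x; label y; label z] /\
  {in [:: w0; w1; w2; w3],
     forall w, free_of [:: label x; label y; label z] w}.
Proof.
set w := (X in well_formed X) => wf.
pose c u := count (fun v => label v == label u).
have cnt u : u \in [:: x; y; z] ->
    c u w0 + c u w1 + c u w2 + c u w3
      + 2 * ((label x == label u) + (label y == label u)
             + (label z == label u)) = 2.
  move=> uxyz; have uw : u \in w.
    rewrite /w !mem_cat !mem_ordered.
    by move: uxyz; rewrite !inE => /or3P[]/eqP->; rewrite eqxx ?orbT.
  have := well_formed_count wf uw.
  by rewrite /c /w !count_cat !count_ordered /=; lia.
have cx := cnt x; have cy := cnt y; have cz := cnt z.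
rewrite !inE !eqxx ?orbT /= in cx cy cz.
move: (cx isT) (cy isT) (cz isT) => {cx cy cz}.
rewrite ![label x == _]eq_sym ![label y == label z]eq_sym => cx cy cz.
split.
  rewrite /= !inE !negb_or andbT; apply/andP; split; [apply/andP; split|];
  by rewrite eq_sym; lia.
by move=> u; rewrite !inE => /or4P[]/eqP->; do !apply: free_cons => //;
  apply: count_free; rewrite -/(c _ _); lia.
Qed.

Lemma transfers_triangle w0 w1 w2 w3 x y z (f1 f2 f3 : bool) :
    leftward x (+) leftward y = f2 (+) f3 ->
    leftward x (+) leftward z = f1 (+) f3 ->
    triangle_levels (level x) (level y) (level z) ->
    well_formed (w0 ++ ordered f1 x y ++ w1 ++ ordered f2 (mate x) z ++ w2
      ++ ordered f3 (mate y) (mate z) ++ w3) ->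
  transfers H (w0 ++ ordered f1 x y ++ w1 ++ ordered f2 (mate x) z ++ w2
      ++ ordered f3 (mate y) (mate z) ++ w3)
    (w0 ++ ordered (~~ f1) x y ++ w1 ++ ordered (~~ f2) (mate x) z ++ w2
      ++ ordered (~~ f3) (mate y) (mate z) ++ w3).
Proof.
move=> e1 e2 lev /triangle_labels[uq fr].
apply: transfers_local (@local_triangle H _ _ _ _ _ _ e1 e2 lev uq) => //;
  by apply: fr; rewrite !inE eqxx ?orbT.
Qed.

Lemma transfers_move c d : well_formed c.1 -> well_formed d.1 -> move c d ->
  transfers H c.1 d.1 /\ transfers H d.1 c.1.
Proof.
move=> wc wd m; case: m wc wd => /=.
- move=> r w s r_inj _ _.
  by split; [exact: transfers_rename | exact: transfers_unrename].
- move=> w s i0 i s' _ _ _ _; rewrite /rot.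
  have := (@transfers_rot H (take i w) (drop i w),
           @transfers_rot H (drop i w) (take i w)).
  by rewrite cat_take_drop => -[].
- by move=> w0 w1 v s _; apply: transfers_loop.
- by move=> w0 w1 w2 u v f s lr lev _; apply: transfers_bigon.
- move=> w0 w1 w2 w3 x y z f1 f2 f3 s e1 e2 lev wc wd.
  split; first exact: transfers_triangle.
  (* the inverse is the same move with the opposite orders of visits *)
  have := @transfers_triangle w0 w1 w2 w3 x y z (~~ f1) (~~ f2) (~~ f3).
  by rewrite !negbK !addbN !addNb !negbK; apply.
Qed.

Lemma transfers_equivalent (D E : diagram) :
  equivalent D E -> transfers H (visits D) (visits E).
Proof.
suff: equivalent D E ->
    transfers H (visits D) (visits E) /\ transfers H (visits E) (visits D).
  by move=> h /h[].
elim=> {D E} [D E m|D|D E _ []//|D E F _ [DE ED] _ [EF FE]].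
- exact: (transfers_move (visits_wf D) (visits_wf E) m).
- by split; apply: transfers_refl.
- by split; [apply: transfers_trans DE EF | apply: transfers_trans FE ED].
Qed.

End Invariance.

(** * The coloring of a diagram in its own group *)

Section Generators.
Variables (X : choiceType) (R : word X -> word X -> Prop).

Lemma genV (x : X) : \pi_(presented R) [:: (x, false)] = (gen R x)^-1.
Proof. exact: (pi_word_inv R [:: (x, true)]). Qed.

Lemma presented_ind (K : {pred presented R}) : group_closed K ->
  (forall x, gen R x \in K) -> forall g, g \in K.
Proof.
move=> gK Kx; elim/quotW; elim=> [|[x b] u IH]; first by case: gK.
rewrite -cat1s pi_word_cat; apply: (group_closedM gK) => //.
case: b; first exact: Kx.
by rewrite genV; apply: (group_closedV gK).
Qed.

End Generators.

Lemma split_count (a : pred visit) (u : seq visit) j : j <= count a u ->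
  exists u1 u2, u = u1 ++ u2 /\ count a u1 = j.
Proof.
elim: u j => [|x u IH] j /=; first by case: j => // _; exists [::], [::].
case: j => [|j]; first by exists [::], (x :: u).
move=> le; have [|u1 [u2 [-> e]]] := IH (j.+1 - a x); first by lia.
by exists (x :: u1), u2; split=> //=; rewrite e; case: (a x) => /=; lia.
Qed.

Section WirtingerColoring.
Variable D : diagram.
Let w := visits D.
Let G : groupType := wirtinger_group D.

Definition over_gen (l : nat) : G :=
  wirtinger_gen
    (arc_at D (find (fun v => (label v == l) && (level v == Over)) w)).

Definition base_gen : G := wirtinger_gen (arc_at D 0).

Lemma over_genE v : v \in w -> level v = Over ->
  over_gen (label v) = wirtinger_gen (arc_at D (index v w)).
Proof.
move=> vw lv; rewrite /over_gen; congr (wirtinger_gen (arc_at D _)).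
apply: eq_in_find => u uw /=; apply/andP/eqP => [[/eqP luv /eqP lu]|->].
  by apply: (visit_unique (visits_wf D)) luv; rewrite ?lu ?lv.
by rewrite eqxx lv eqxx.
Qed.

Lemma wirtinger_relation v : v \in w -> level v = Over ->
  let k := index (mate v) w in
  let y := arc_at D (index v w) in
  let x := if leftward v then arc_at D k.+1 else arc_at D k in
  let z := if leftward v then arc_at D k else arc_at D k.+1 in
  wirtinger_gen z = (wirtinger_gen x : G) ^ wirtinger_gen y.
Proof.
move=> vw lv k y x z.
have /presentedP : word_eq (@wirtinger_rel D)
    [:: (z, true)] [:: (y, false); (x, true); (y, true)].
  exact: (rst_step _ _ _ _ (WordRel [::] [::] (WirtingerRel vw lv))).
by rewrite -(cat1s (y, false)) -(cat1s (x, true)) !pi_word_cat genV.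
Qed.

(** The relation at a crossing is solved for the outgoing under arc: whichever
   side the over strand comes from, this is the rule of [cross]. *)
Lemma run_wirtinger w1 w2 : w = w1 ++ w2 ->
  run over_gen base_gen w1 = wirtinger_gen (arc_at D (size w1)).
Proof.
elim/last_ind: w1 w2 => // w1 u IH w2; rewrite cat_rcons => e.
rewrite -cats1 run_cat (IH _ e) /= /cross size_cat addn1.
have uw : u \in w by rewrite e mem_cat mem_head orbT.
have iu : index u w = size w1.
  by rewrite e index_split // -e; apply: well_formed_uniq (visits_wf D).
case: eqP => [lu|/eqP/negbTE lu]; last first.
  congr wirtinger_gen; rewrite /arc_at -/w e take_size_cat // -cat_rcons.
  by rewrite take_size_cat ?size_rcons // -cats1 count_cat /= lu !addn0.
have mw : mate u \in w by case/andP: (allP (visits_wf D) u uw).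
have mu : mate (mate u) = u by case: (u) => l b []; rewrite /mate /= negbK.
have := wirtinger_relation mw; rewrite /= lu => /(_ erefl).
have := over_genE mw; rewrite /= lu => /(_ erefl) ->.
by rewrite mu iu; case: (leftward u) => /= ->; rewrite ?conjgK.
Qed.

Lemma arc_at_size : arc_at D (size w) = arc_at D 0.
Proof.
apply: val_inj; rewrite /= take_size take0 /= -/(n_under D) mod0n.
by case: (n_under D) => // n; rewrite modnn.
Qed.

Lemma coloring_wirtinger : coloring over_gen base_gen w.
Proof.
apply/andP; split; last first.
  by rewrite (@run_wirtinger _ [::]) ?cats0 // /base_gen arc_at_size.
apply/compatibleP=> w1 v w2 e lv; rewrite (run_wirtinger e).
have vw : v \in w by rewrite e mem_cat mem_head orbT.
rewrite over_genE //; congr (wirtinger_gen (arc_at D _)).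
by rewrite e index_split // -e; apply: well_formed_uniq (visits_wf D).
Qed.

Lemma wirtinger_gen_run (a : wirtinger_arc D) : exists w1 w2, w = w1 ++ w2 /\
  wirtinger_gen a = run over_gen base_gen w1.
Proof.
have [|w1 [w2 [e ea]]] := @split_count (fun v => level v == Under) w a.
  by have := ltn_ord a; rewrite -/(n_under D); lia.
exists w1, w2; split=> //; rewrite (run_wirtinger e); congr wirtinger_gen.
by rewrite /arc_at -/w e take_size_cat // ea valZpK.
Qed.

Lemma wirtinger_colors_in (K : {pred G}) :
  group_closed K -> colors_in K over_gen base_gen w -> forall g, g \in K.
Proof.
move=> gK Kw; apply: presented_ind => // a; rewrite -/(wirtinger_gen a).
have [w1 [w2 [e ->]]] := wirtinger_gen_run a.
by move: Kw; rewrite e => /(colors_in_cat _ _ _ _ gK)[/(colors_in_run gK)].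
Qed.

Lemma wirtinger_normally_generated (a : wirtinger_arc D) (K : {pred G}) :
    group_closed K -> (forall g, (wirtinger_gen a : G) ^ g \in K) ->
  forall g, g \in K.
Proof.
move=> gK Ka; apply: presented_ind => // b; rewrite -/(wirtinger_gen b).
have [w1 [_ [_ ea]]] := wirtinger_gen_run a.
have [w2 [_ [_ ->]]] := wirtinger_gen_run b.
have [g eg] := run_conj over_gen base_gen w1.
have [h ->] := run_conj over_gen base_gen w2.
have -> : base_gen ^ h = (wirtinger_gen a : G) ^ (g^-1 * h); last exact: Ka.
by rewrite ea eg -conjgM mulVKg.
Qed.

End WirtingerColoring.

(** * Quotients of groups *)

Section Quotient.
Variables (G : groupType) (N : {pred G}).
Hypotheses (gN : group_closed N) (nN : forall g x, x \in N -> x ^ g \in N).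

Definition letter_value (a : G * bool) : G := if a.2 then a.1 else a.1^-1.
Definition word_value (u : word G) : G :=
  foldr (fun a g => letter_value a * g) 1 u.

(** The quotient G/N is presented by the elements of G as generators, with all
   the relations which hold modulo N. *)
Definition same_coset (l r : word G) : Prop :=
  (word_value l)^-1 * word_value r \in N.

Lemma word_value_cat u v : word_value (u ++ v) = word_value u * word_value v.
Proof. by elim: u => [|a u IH] /=; rewrite ?mul1g // IH mulgA. Qed.

Lemma same_coset_sym u v : same_coset u v -> same_coset v u.
Proof. by move/(group_closedV gN); rewrite /same_coset invgM invgK. Qed.

Lemma word_eq_coset u v : word_eq same_coset u v -> same_coset u v.
Proof.
elim=> {u v} [_ _ []|u|u v _|u v t _ uv _ vt].
- move=> u v x b; rewrite /same_coset !word_value_cat /=.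
  suff -> : letter_value (x, b) * (letter_value (x, ~~ b) * 1) = 1.
    by rewrite mul1g mulVg; case: gN.
  by rewrite /letter_value; case: b; rewrite /= mulg1 ?mulgV ?mulVg.
- move=> u v l r /(nN (word_value v)); rewrite /same_coset !word_value_cat.
  by rewrite conjgE !invgM !mulgA mulgVK.
- by rewrite /same_coset mulVg; case: gN.
- exact: same_coset_sym.
- by have := group_closedM gN uv vt; rewrite /same_coset mulgA mulgK.
Qed.

Lemma quotient_group : exists (Q : groupType) (phi : G -> Q),
  {morph phi : x y / x * y} /\ forall x, phi x = 1 <-> x \in N.
Proof.
exists (presented same_coset), (gen same_coset); split=> x.
  move=> y; rewrite /gen -[RHS]/(presented_mul _ _) -pi_word_cat.
  apply/presentedP/rst_step; apply: (WordRel [::] [::]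
    (l := [:: (x * y, true)]) (r := [:: (x, true); (y, true)])).
  by rewrite /same_coset /= !mulg1 /letter_value /= mulVg; case: gN.
split=> [/presentedP/word_eq_coset/same_coset_sym|Nx].
  by rewrite /same_coset /= invg1 mul1g mulg1.
apply/presentedP/rst_sym/rst_step.
apply: (WordRel [::] [::] (l := [::]) (r := [:: (x, true)])).
by rewrite /same_coset /= invg1 mul1g mulg1.
Qed.

End Quotient.

Section Morphism.
Variables (G Q : groupType) (phi : G -> Q).
Hypothesis phiM : {morph phi : x y / x * y}.

Lemma morph1 : phi 1 = 1.
Proof. by apply: (mulgI (phi 1)); rewrite -phiM !mulg1. Qed.

Lemma morphV : {morph phi : x / x^-1}.
Proof. by move=> x; apply: (mulgI (phi x)); rewrite -phiM !mulgV morph1. Qed.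

Lemma morphJ : {morph phi : x y / x ^ y}.
Proof. by move=> x y; rewrite !conjgE !phiM morphV. Qed.

Lemma run_morph o p w : run (phi \o o) (phi p) w = phi (run o p w).
Proof.
elim: w p => //= v w IH p; rewrite -IH; congr (run _ _ _); rewrite /cross.
by case: eqP => // _; case: ifP => _ /=; rewrite morphJ ?morphV.
Qed.

Lemma coloring_morph o p w : coloring o p w -> coloring (phi \o o) (phi p) w.
Proof.
case/andP=> /compatibleP C /eqP R; apply/andP; split.
  by apply/compatibleP => w1 v w2 e lv; rewrite run_morph (C _ _ _ e lv).
by rewrite run_morph R.
Qed.

(** If each subgroup which contains [q] contains the image of [phi], then this
   image is commutative: the centralizer of [q] is such a subgroup, hence the
   centralizer of the image contains [q] and is such a subgroup as well. *)
Lemma commute_of_single_color q :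
    (forall K : {pred Q}, group_closed K -> q \in K -> forall g, phi g \in K) ->
  forall x y, commute (phi x) (phi y).
Proof.
move=> all; pose C (S : Q -> Prop) := [pred x | `[< forall y, S y -> commute x y >]].
have gC S : group_closed (C S).
  split; first by apply/asboolP => y _; apply/commute_sym/commute1.
  move=> x y /asboolP cx /asboolP cy; apply/asboolP => z Sz.
  by apply/commute_sym/commuteM; [|apply: commuteV]; apply/commute_sym;
    [apply: cx | apply: cy].
have qc g : commute (phi g) q.
  have /asboolP : phi g \in C (eq q); last by apply.
  by apply: all => //; apply/asboolP => _ <-.
move=> x y; have /asboolP : phi x \in C (fun z => exists g, z = phi g).
  by apply: all => //; apply/asboolP => _ [g ->]; apply/commute_sym/qc.
by apply; exists y.
Qed.

End Morphism.

(** * Generators of the module *)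

Section Span.
Variables (G : groupType) (h : G).
Hypothesis normally_generated :
  forall K : {pred G}, group_closed K -> (forall g, h ^ g \in K) -> forall g, g \in K.
Local Open Scope ring_scope.
Local Notation M := (commutator_module h).
Local Notation cls x := (\pi_(commutator_quotient G) x : M).

Lemma conj_module_t :
  exists c : laurent, forall v : M, conj_module h v = c *: v.
Proof.
have tP : @tofrac {poly int} 'X / @tofrac {poly int} 'X^0 \in laurent_pred.
  by apply/asboolP; exists 'X, 0%N.
exists (Laurent tP) => v; symmetry.
rewrite [LHS](@laurent_actE _ _ _ (conj_moduleD h) (conj_moduleK h)
  (conj_moduleVK h) _ v 'X 0%N) //.
by rewrite -['X]mul1r poly_actMX -[1]/(1%:P) poly_actC mulr1z.
Qed.

Lemma conj_module_tV :
  exists c : laurent, forall v : M, conj_module (h^-1)%g v = c *: v.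
Proof.
have tP : @tofrac {poly int} 1 / @tofrac {poly int} 'X^1 \in laurent_pred.
  by apply/asboolP; exists 1, 1%N.
exists (Laurent tP) => v; symmetry.
rewrite [LHS](@laurent_actE _ _ _ (conj_moduleD h) (conj_moduleK h)
  (conj_moduleVK h) _ v 1 1%N) //.
by rewrite -[1]/(1%:P) poly_actC mulr1z.
Qed.

Lemma conj_moduleM (g k : G) (v : commutator_quotient G) :
  conj_module (g * k)%g v = conj_module k (conj_module g v).
Proof.
elim/quotW: v => x; rewrite (conj_module_pi g) (conj_module_pi k) conj_module_pi.
congr (\pi_(commutator_quotient G) _); apply: val_inj; exact: conjgM.
Qed.

Lemma conj_module_derived (g : G) (v : commutator_quotient G) :
  g \in derived predT -> conj_module g v = v.
Proof.
move=> Gg; elim/quotW: v => x; rewrite conj_module_pi.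
apply/commutator_quotientP; rewrite dcongr_sym /dcongr /= -commgEl.
by apply: derived_comm => //; exact: valP.
Qed.

(** G' acts trivially on G'/G'' and h ^ g differs from h by a commutator, so the
   elements which act by a scalar, together with their inverses, form a
   subgroup which contains all the conjugates of h. *)
Lemma conj_module_scalar (g : G) :
  exists c : laurent, forall v : M, conj_module g v = c *: v.
Proof.
pose scalar k := exists c : laurent, forall v : M, conj_module k v = c *: v.
have scalarM k l : scalar k -> scalar l -> scalar (k * l)%g.
  move=> [c ck] [d dl]; exists (d * c) => v.
  by rewrite conj_moduleM -scalerA -ck -dl.
have scalarG' k : k \in derived predT -> scalar k.
  by move=> Gk; exists 1 => v; rewrite scale1r conj_module_derived.
suff /(_ g)/asboolP[] :
    forall g, g \in [pred k | `[< scalar k /\ scalar k^-1%g >]] by [].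
apply: normally_generated.
  have Gd := derived_closed (@predT G).
  split; first by apply/asboolP; rewrite invg1; split; apply: scalarG'; case: Gd.
  move=> k l /asboolP[sk sk'] /asboolP[sl sl']; apply/asboolP.
  by rewrite invgM invgK; split; apply: scalarM.
move=> k; apply/asboolP; rewrite -conjVg.
have conjE x : (x ^ k = x * [~ x, k])%g by rewrite commgEl mulVKg.
have scalar_comm x : scalar [~ x, k]%g by apply/scalarG'/derived_comm.
by split; rewrite conjE; apply: scalarM => //;
  [exact: conj_module_t | exact: conj_module_tV].
Qed.

Variables (k : nat) (r : 'I_k -> commutator_subgroup G).

Definition spanned (x : G) : Prop := exists2 y : commutator_subgroup G,
  dval y = x & exists c : 'I_k -> laurent, cls y = \sum_i c i *: cls (r i).

Lemma cls_mul (x y : commutator_subgroup G) : cls (x * y)%g = cls x + cls y.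
Proof. exact: pi_mulg. Qed.

Lemma cls_inv (x : commutator_subgroup G) : cls (x^-1)%g = - cls x.
Proof. by apply: (addrI (cls x)); rewrite -cls_mul mulgV subrr. Qed.

Lemma spanned_closed : group_closed [pred x | `[< spanned x >]].
Proof.
split.
  apply/asboolP; exists 1%g => //; exists (fun=> 0).
  by rewrite big1 // => i _; rewrite scale0r.
move=> _ _ /asboolP[x <- [c ec]] /asboolP[y <- [d ed]]; apply/asboolP.
exists (x * y^-1)%g; first by rewrite [LHS]valM.
exists (fun i => c i - d i); rewrite cls_mul cls_inv ec ed -sumrB.
by apply: eq_bigr => i _; rewrite scalerBl.
Qed.

Lemma spanned_conj g x : spanned x -> spanned (x ^ g)%g.
Proof.
move=> [y <- [c ec]]; exists (conj_sub g y) => //.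
have [d ed] := conj_module_scalar g.
exists (fun i => d * c i).
rewrite -conj_module_pi [LHS]ed ec scaler_sumr.
by apply: eq_bigr => i _; rewrite scalerA.
Qed.

(** The hypothesis is applied to the normal subgroup of the spanned elements,
   which then contains G'. *)
Lemma generates_of_abelian :
    (forall N : {pred G}, group_closed N ->
       (forall g x, x \in N -> (x ^ g)%g \in N) ->
       (forall i, dval (r i) \in N) -> forall x y, [~ x, y]%g \in N) ->
  generates (fun i => cls (r i)).
Proof.
move=> ab; elim/quotW=> x.
have /asboolP/(_ [pred x | `[< spanned x >]]) : dval x \in derived predT := valP x.
case/(_ spanned_closed _)/asboolP; last first.
  by move=> y /val_inj -> [c ec]; exists c.
move=> _ /asboolP[y _ [z _ ->]]; apply: (ab) => //.
- exact: spanned_closed.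
- by move=> g u /asboolP su; apply/asboolP/spanned_conj.
- move=> i; apply/asboolP; exists (r i) => //; exists (fun j => (i == j)%:R).
  rewrite (bigD1 i) //= eqxx scale1r big1 ?addr0 // => j.
  by rewrite eq_sym => /negbTE->; rewrite scale0r.
Qed.

End Span.

Lemma min_generators_le (M : lmodType laurent) k (u : 'I_k -> M) :
  generates u -> exists e, min_generators M e /\ e <= k.
Proof.
move=> gu; pose P e := `[< exists u : 'I_e -> M, generates u >].
have exP : exists e, P e by exists k; apply/asboolP; exists u.
case: (ex_minnP exP) => e /asboolP He emin; exists e; split; last first.
  by apply: emin; apply/asboolP; exists u.
by split=> // l v gv; apply: emin; apply/asboolP; exists v.
Qed.

(** * Virtualizations and crossing changes *)

(** A virtualized crossing must not change the color of its under strand.  At a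
   changed crossing the two strands must have the same color, and then neither
   of them has its color changed by passing under the other. *)
Lemma alter_coloring (H : groupType) (o : nat -> H) p A B w :
    compatible o p w ->
    (forall w1 v w2, w = w1 ++ v :: w2 -> level v = Under ->
      (label v \in A -> run o p (rcons w1 v) = run o p w1) /\
      (label v \in B -> o (label v) = run o p w1)) ->
  compatible o p (map (alter A B) w) /\
  run o p (map (alter A B) w) = run o p w.
Proof.
elim: w p => //= v w IH p /andP[Cv C] h.
have {}IH : compatible o (cross o p v) (map (alter A B) w) /\
    run o (cross o p v) (map (alter A B) w) = run o p (v :: w).
  by apply: IH => // w1 u w2 e lu; apply: (h (v :: w1) u w2); rewrite //= e.
have [hA hB] : (level v = Under -> label v \in A -> cross o p v = p) /\
    (level v = Under -> label v \in B -> o (label v) = p).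
  by split=> lv; have := h [::] v w erefl lv => -[hA hB].
suff [-> ->] : cross o p (alter A B v) = cross o p v /\
    ((level (alter A B v) == Over) ==> (p == o (label v))) by [].
move: hA hB Cv; rewrite /cross /alter; case: v {h C IH} => l b a /= hA hB Cv.
case: (l \in A) hA => [hA|_]; first by case: a hA {hB Cv} => //= /(_ erefl isT) ->.
case: (l \in B) hB => [hB|_]; last by [].
case: a hB Cv => //= [_ /eqP->|/(_ erefl isT) -> _]; rewrite ?eqxx //;
  by case: b; rewrite ?conjgg ?conjgVg.
Qed.

(** The element to be killed for the crossing [l] to be virtualized (if it is in
   [A]) or changed (otherwise); [v] is its under visit. *)
Definition crossing_defect (G : groupType) (o : nat -> G) p (A : seq nat)
    (w : seq visit) (l : nat) (g : G) : Prop :=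
  forall w1 v w2, w = w1 ++ v :: w2 -> level v = Under -> label v = l ->
    g = (run o p w1)^-1 * (if l \in A then run o p (rcons w1 v) else o l).

Lemma crossing_defect_exists (D : diagram) (G : groupType) (o : nat -> G) p A l :
    compatible o p (visits D) -> l \in real_crossings D ->
  exists y : commutator_subgroup G, crossing_defect o p A (visits D) l (dval y).
Proof.
move=> C /mapP[v]; rewrite mem_filter => /andP[/eqP lv vw] ->.
have [|w3 [_ [_ eo]]] := over_color_run (visits_wf D) C vw; first by rewrite lv.
have := visits_wf D; rewrite /crossing_defect; case/splitPr: vw => w1 w2 wf.
have dP : (run o p w1)^-1 *
    (if label v \in A then run o p (rcons w1 v) else o (label v))
    \in derived predT.
  by case: ifP => _; rewrite ?eo; apply: run_ratio_derived.
exists (CommutatorSubgroup dP) => w1' u w2' e lu luv /=.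
by have [-> ->] := under_split_unique wf e lv lu (esym luv).
Qed.

(** Modulo [N] the coloring is a coloring of the altered diagram [D'], hence of
   a diagram with a single color. *)
Lemma altered_commutators (D D' : diagram) A B (G : groupType) (o : nat -> G) p
    (N : {pred G}) :
    code D' = (map (alter A B) (visits D), (code D).2) -> trivial_diagram D' ->
    uniq (A ++ B) -> coloring o p (visits D) ->
    (forall K : {pred G},
       group_closed K -> colors_in K o p (visits D) -> forall g, g \in K) ->
    group_closed N -> (forall g x, x \in N -> x ^ g \in N) ->
    (forall l, l \in A ++ B ->
       exists2 g, g \in N & crossing_defect o p A (visits D) l g) ->
  forall x y, [~ x, y] \in N.
Proof.
move=> eD' [O O0 D'O] uAB col gen gN nN Ndef x y.
have [Q [phi [phiM phi1]]] := quotient_group gN nN.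
have defect l w1 v w2 : l \in A ++ B ->
    visits D = w1 ++ v :: w2 -> level v = Under -> label v = l ->
    phi (run o p w1) = phi (if l \in A then run o p (rcons w1 v) else o l).
  move=> /Ndef[g Ng dg] e lv vl; move: Ng; rewrite (dg _ _ _ e lv vl) => Ng.
  apply: (mulgI (phi (run o p w1))^-1); rewrite mulVg -(morphV phiM) -phiM.
  by symmetry; apply/phi1.
have /andP[C _] := col; have /andP[CQ RQ] := coloring_morph phiM col.
have alterD w1 w2 : visits D = w1 ++ w2 ->
    compatible (phi \o o) (phi p) (map (alter A B) w1) /\
    run (phi \o o) (phi p) (map (alter A B) w1) = run (phi \o o) (phi p) w1.
  move=> e; apply: alter_coloring.
    by move: CQ; rewrite e compatible_cat => /andP[].
  move=> u1 v u2 e1 lv; rewrite !(run_morph phiM).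
  have e0 : visits D = u1 ++ v :: (u2 ++ w2) by rewrite e e1 -catA.
  split=> vl.
    have vAB : label v \in A ++ B by rewrite mem_cat vl.
    by rewrite (defect _ _ _ _ vAB e0 lv erefl) vl.
  have vAB : label v \in A ++ B by rewrite mem_cat vl orbT.
  rewrite (defect _ _ _ _ vAB e0 lv erefl) ifN //.
  by move: uAB; rewrite cat_uniq => /and3P[_ /hasPn/(_ _ vl)].
have vD' : visits D' = map (alter A B) (visits D) by rewrite /visits eD'.
have colD' : coloring (phi \o o) (phi p) (visits D').
  have [C' R'] := alterD (visits D) [::] (esym (cats0 _)).
  by rewrite vD' /coloring C' R' RQ.
have [oq [q [_ sq]]] := transfers_equivalent D'O colD'.
have com : forall g h, commute (phi g) (phi h).
  apply: (commute_of_single_color (q := q)) => K gK Kq g.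
  apply: (gen [pred g | phi g \in K]).
    split; first by rewrite inE (morph1 phiM); case: gK.
    by move=> u v; rewrite !inE phiM (morphV phiM); apply: gK.2.
  have [] : colors_in K (phi \o o) (phi p) (visits D').
    by apply: sq => //; rewrite O0; split.
  rewrite vD' => Kp Ko; split=> [|v vw lv]; first by rewrite inE.
  (* a virtualized crossing has no over color any more, but the color of its
     former over strand is still the color of an arc of D' *)
  have [w1 [w2 [e eo]]] := over_color_run (visits_wf D) C vw lv.
  rewrite eo inE -(run_morph phiM) -(alterD _ _ e).2; apply: colors_in_run => //.
  by split=> // u uw; apply: Ko; rewrite e map_cat mem_cat uw.
apply/phi1; rewrite commgEl conjgE !(phiM, morphV phiM) (com x y).
by rewrite !mulgA mulgVK mulVg.
Qed.

(** * The theorem *)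

(* The group G of K is presented by any diagram [D] of K, and t acts on
   M = G'/G'' by conjugation by the generator of any arc [a] of [D].  The
   conclusion includes the existence of e(M). *)
Theorem theorem5p1 (K : virtual_knot) (m n : nat)
    (hU : unknotting_index K m n)
    (D : diagram) (hD : presents D K) (a : wirtinger_arc D) :
  exists e : nat, min_generators (virtual_knot_module D a) e /\ (e <= m + n)%N.
Proof.
case: hU => -[D0 hD0 [[A [B [D' [[uAB sAB] sA sB eD' tD']]]] _]] _.
have DD0 : equivalent D D0.
  apply/asboolP; have /eqmodP : \pi_virtual_knot D = \pi_virtual_knot D0.
    by rewrite hD hD0.
  by [].
pose G : groupType := wirtinger_group D.
have [o [p [col sup]]] :=
  @transfers_equivalent G _ _ DD0 _ _ (coloring_wirtinger D).
have /andP[C _] := col.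
pose def l (y : commutator_subgroup G) :=
  crossing_defect o p A (visits D0) l (dval y).
have [r rP] : {r : 'I_(size (A ++ B)) -> commutator_subgroup G &
    forall i, def (tnth (in_tuple (A ++ B)) i) (r i)}.
  apply: (boolp.choice (P := fun i => def (tnth (in_tuple (A ++ B)) i))) => i.
  by apply: crossing_defect_exists => //; apply: sAB; apply: mem_tnth.
have <- : size (A ++ B) = m + n by rewrite size_cat sA sB.
apply: (@min_generators_le (virtual_knot_module D a) _
  (fun i => \pi_(commutator_quotient G) (r i))).
apply: (generates_of_abelian (@wirtinger_normally_generated D a)) => N gN nN rN.
apply: altered_commutators eD' tD' uAB col _ gN nN _ => [L gL|l lAB].
  by move=> /(sup _ gL)/(wirtinger_colors_in gL).
have li : index l (A ++ B) < size (A ++ B) by rewrite index_mem.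
exists (dval (r (Ordinal li))) => //; have := rP (Ordinal li).
by rewrite /def (tnth_nth l) /= nth_index.
Qed.
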